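(* Let $\varepsilon\in(0,1/2)$, let $n^{1/2+\varepsilon}\leq d=d(n)\leq n/2$ (with $dn$ even), let $\mathbf{G}_n\sim\mathcal{G}_{n,d}$, and let $k\in\mathbb{N}$ be an arbitrary constant. Then with high probability the following holds: for every non-trivial partition $[n]=V_1\sqcup V_2$ of the vertex set of $\mathbf{G}_n$, after two rounds of colour refinement (started from the colouring given by this partition) there exists a partition $[n]=W_1\sqcup\dots\sqcup W_k$ such that for every $i\in[k]$, $n/(3k)\le|W_i|\le 3n/k$ and $W_i$ is a union of some colour classes.
   Context: $\mathcal{G}_{n,d}$ is the uniform distribution over $d$-regular graphs on $[n]=\{1,\dots,n\}$; ''with high probability'' means with probability tending to $1$ as $n\to\infty$. Colour refinement: from a colouring $C_{t-1}$, $C_t(v)=(C_{t-1}(v),\{\!\{C_{t-1}(w):w\in N(v)\}\!\})$ (multiset of neighbours' colours); the initial colouring gives colour $i$ to vertices of $V_i$. A two-part partition is non-trivial if both parts are non-empty. *)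

(* Defs.v *)
From HB Require Import structures.
From mathcomp Require Import all_boot all_order all_algebra.
From mathcomp Require Import finmap multiset.
From mathcomp Require Import boolp reals.

Set Implicit Arguments.
Unset Strict Implicit.
Unset Printing Implicit Defensive.

Local Open Scope ring_scope.

Definition simple_nbrs (T : finType) (N : {ffun T -> {set T}}) : bool :=
  [forall u, forall v, (u \in N v) == (v \in N u)]
  && [forall v, v \notin N v].

(* A simple graph on T is given by its neighbourhood function. *)
Record sgraph (T : finType) := SGraph {
  nbrs : {ffun T -> {set T}};
  nbrsP : simple_nbrs nbrs }.

HB.instance Definition _ (T : finType) := [isSub for @nbrs T].
HB.instance Definition _ (T : finType) := [Choice of sgraph T by <:].
HB.instance Definition _ (T : finType) := [Countable of sgraph T by <:].
HB.instance Definition _ (T : finType) := [Finite of sgraph T by <:].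

Definition regular_graphs (T : finType) (d : nat) : {set sgraph T} :=
  [set G : sgraph T | [forall v, #|nbrs G v| == d]].

(* Vertices are 'I_n rather than {1, ..., n}.  The value is 0 when there is no
   d-regular graph on n vertices; one exists whenever d < n and d * n is
   even. *)
Definition regular_graph_prob (R : realType) (n d : nat)
    (E : sgraph 'I_n -> Prop) : R :=
  #|[set G in regular_graphs 'I_n d | `[< E G >]]|%:R
  / #|regular_graphs 'I_n d|%:R.

Definition refine_colouring (T : finType) (K : choiceType) (G : sgraph T)
    (C : T -> K) : T -> (K * {mset K}%mset)%type :=
  fun v => (C v, seq_mset [seq C w | w <- enum (nbrs G v)]).

Definition nontrivial_bipartition (T : finType) (V1 V2 : {set T}) : Prop :=
  [/\ V1 != set0, V2 != set0, V1 :&: V2 = set0 & V1 :|: V2 = [set: T]].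

(* Colour 2 is given to the complement of V1, the other part V2. *)
Definition two_part_colouring (T : finType) (V1 : {set T}) : T -> nat :=
  fun v => if v \in V1 then 1%N else 2%N.

Definition colour_classes (T : finType) (K : choiceType) (C : T -> K) :
    {set {set T}} :=
  preim_partition C [set: T].

Definition union_of_colour_classes (T : finType) (K : choiceType)
    (C : T -> K) (W : {set T}) : Prop :=
  exists2 P : {set {set T}}, P \subset colour_classes C & W = cover P.

Definition partition_family (T I : finType) (W : I -> {set T}) : Prop :=
  (forall i j, i != j -> W i :&: W j = set0)
  /\ \bigcup_(i in I) W i = [set: T].

(* Main.v *)
(** Take disjoint pairs (x_j, t_j) with x_j in S and t_j outside S.  At every
    vertex w outside the pairs that is adjacent to exactly one of x_j, t_j,
    one may decide afresh to which of the two it is joined; as long as x_j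
    keeps its degree, the graph stays d-regular.  Under independent fair
    choices the graph stays regular with probability at least
    (4^r (n+1))^-r for r pairs, whereas a vertex w split by many pairs has a
    prescribed degree into S only with small probability, independently for
    different w.  Double counting thus bounds the number of d-regular graphs
    in which many such w have the same number of neighbours in S.

    If r <= |S| <= n/2 and linearly many w have the same degree into S, some
    r = O(n/d) pairs split half of these w at least K times, because a set of
    d vertices splits a fraction at least d/2n of S x ~S.  As r^2 = o(n), a
    union bound over S, the set of w and the pairs shows that whp every set S
    with r <= |S| <= n - r has only small level sets of the degree into S.
    With a single pair, the same count shows that whp for 0 < |S| < r no
    degree into S is shared by all but 2r vertices.

    After the first round all degrees into the smaller part S are visible, so
    that some union of colour classes Q (S itself if |S| >= r, otherwise a
    sublevel set of the degree into S) has r <= |Q| <= n - r.  The second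
    round separates vertices with different degrees into Q, so every colour
    class is small, and small classes can be packed into k balanced unions. *)

Require Import Defs.
From mathcomp Require Import all_boot all_order all_algebra.
From mathcomp Require Import zify ring lra.

Set Implicit Arguments.
Unset Strict Implicit.
Unset Printing Implicit Defensive.

(** * Estimates for binomial coefficients *)

Lemma leq_bin_central_step n i : (i.*2 < n)%N -> ('C(n, i) <= 'C(n, i.+1))%N.
Proof.
move=> lt_in; rewrite -(@leq_pmul2l i.+1) // mul_bin_left leq_mul2r.
by apply/orP; right; lia.
Qed.

Lemma leq_bin_central m i : ('C(m.*2, i) <= 'C(m.*2, m))%N.
Proof.
have low j : (j <= m)%N -> ('C(m.*2, m - j) <= 'C(m.*2, m))%N.
  elim: j => [|j IHj] ltjm; first by rewrite subn0.
  apply: leq_trans (IHj (ltnW ltjm)).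
  have -> : (m - j)%N = (m - j.+1).+1 by lia.
  by apply: leq_bin_central_step; lia.
case: (leqP i m) => [le_im | lt_mi]; first by rewrite -(subKn le_im); apply: low; lia.
case: (leqP i m.*2) => [le_i2m | lt_2mi]; last by rewrite bin_small.
rewrite -bin_sub //; have -> : (m.*2 - i = m - (i - m))%N by lia.
by apply: low; lia.
Qed.

Lemma mul_bin_centralS m :
  (m.+1 * 'C(m.+1.*2, m.+1) = 2 * m.*2.+1 * 'C(m.*2, m))%N.
Proof.
have h1 : (m.+1 * 'C(m.+1.*2, m.+1) = m.*2.+2 * 'C(m.*2.+1, m))%N.
  by rewrite doubleS -mul_bin_diag.
have h2 : (m.*2.+1 * 'C(m.*2, m) = m.+1 * 'C(m.*2.+1, m))%N.
  by have := mul_bin_down m.*2.+1 m; rewrite /= => ->; congr (_ * _)%N; lia.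
by rewrite h1 -mulnA h2; lia.
Qed.

(** The bound 4^m / sqrt(2m + 1) on the central coefficient, squared so as to stay in the naturals.
    The induction rests on (2m + 1)(2m + 3) being at most (2m + 2)^2. *)
Lemma central_bin_ub m : (m.*2.+1 * 'C(m.*2, m) ^ 2 <= 16 ^ m)%N.
Proof.
elim: m => // m IHm.
rewrite -(@leq_pmul2l (m.+1 ^ 2)) ?expn_gt0 //.
have -> : (m.+1 ^ 2 * (m.+1.*2.+1 * 'C(m.+1.*2, m.+1) ^ 2)
         = m.*2.+3 * (m.+1 * 'C(m.+1.*2, m.+1)) ^ 2)%N.
  by rewrite expnMn doubleS mulnCA.
rewrite mul_bin_centralS [(16 ^ _)%N]expnS.
have hx : (4 * m.*2.+3 * m.*2.+1 <= 16 * m.+1 ^ 2)%N by rewrite -mulnn; nia.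
have -> : (m.*2.+3 * (2 * m.*2.+1 * 'C(m.*2, m)) ^ 2
      = (4 * m.*2.+3 * m.*2.+1) * (m.*2.+1 * 'C(m.*2, m) ^ 2))%N.
  by rewrite -!mulnn; lia.
by apply: leq_trans (leq_mul hx IHm) _; rewrite mulnCA mulnA.
Qed.

Lemma central_bin_lb m : (4 ^ m <= m.*2.+1 * 'C(m.*2, m))%N.
Proof.
elim: m => // m IHm.
rewrite -(@leq_pmul2l m.+1) // mulnCA mul_bin_centralS expnS.
apply: (@leq_trans (m.+1 * 4 * (m.*2.+1 * 'C(m.*2, m)))%N); first nia.
rewrite doubleS; nia.
Qed.

(** By Pascal's rule an entry of one row is a sum of at most two entries of the row above, so the
    largest entry of row [k] divided by 2^k never increases with [k]. *)
Lemma bin_spread_step q K :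
  (forall i, 'C(K, i) * 2 ^ q <= 2 ^ K)%N ->
  forall k i, (K <= k)%N -> ('C(k, i) * 2 ^ q <= 2 ^ k)%N.
Proof.
move=> hK k i leKk; rewrite -(subnK leKk); elim: (k - K)%N i => [|j IHj] i.
  exact: hK.
rewrite addSn expnS; case: i => [|i]; first by have := IHj 0%N; rewrite !bin0; lia.
by rewrite binS mulnDl; have := IHj i; have := IHj i.+1; lia.
Qed.

(** The largest probability of a binomial distribution with [k] fair coins decays like k^(-1/2), so
    it falls below 2^-q once [k] is of order 4^q. *)
Lemma bin_spread q :
  exists K, forall k i, (K <= k)%N -> ('C(k, i) * 2 ^ q <= 2 ^ k)%N.
Proof.
have spread_even m : (4 ^ q <= m.*2.+1)%N -> forall i, ('C(m.*2, i) * 2 ^ q <= 2 ^ m.*2)%N.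
  move=> le_qm i.
  have e1 : ((2 ^ q) ^ 2 = 4 ^ q)%N by rewrite -expnM mulnC expnM.
  have e2 : ((2 ^ m.*2) ^ 2 = 16 ^ m)%N by rewrite -expnM -muln2 -mulnA mulnC expnM.
  rewrite -leq_sqr expnMn e1 e2 mulnC.
  apply: leq_trans (central_bin_ub m); apply: leq_mul => //.
  by rewrite leq_sqr leq_bin_central.
by exists (4 ^ q).*2; apply: bin_spread_step; apply: spread_even; lia.
Qed.

Lemma bin_spread1 k i : (0 < k)%N -> ('C(k, i) * 2 ^ 1 <= 2 ^ k)%N.
Proof. by apply: bin_spread_step => -[|[|j]]; rewrite ?binS ?bin0 ?bin_small. Qed.

(** Shrinking the larger of [a] and [b] to the smaller one leads to a central coefficient, at the
    cost of a factor 2^c. *)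
Lemma bin_near_central a b c :
  (a <= b + c)%N -> (b <= a + c)%N ->
  (2 ^ (a + b) <= (a + b).+1 * 2 ^ c * 'C(a + b, a))%N.
Proof.
wlog le_ab : a b / (a <= b)%N => [hw leabc lebac|].
  case: (leqP a b) => [leab | /ltnW leba]; first exact: hw.
  have := hw b a leba lebac leabc; rewrite [(b + a)%N]addnC.
  by rewrite -(bin_sub (leq_addr b a)) addKn.
move=> _ lebac.
have h1 : ('C(a.*2, a) <= 'C(a + b, a))%N by apply: leq_bin2l; lia.
have h2 := central_bin_lb a.
apply: (@leq_trans (4 ^ a * 2 ^ c)%N).
  by rewrite -[4]/(2 ^ 2)%N -expnM -expnD leq_exp2l; lia.
rewrite mulnAC leq_mul2r; apply/orP; right.
by apply: leq_trans h2 _; apply: leq_mul => //; lia.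
Qed.

(** * Counting subsets by the sizes of their intersections *)

Section Draws.
Variable T : finType.
Implicit Types A B C Z : {set T}.

Lemma card_capped_draws Z i :
  (#|[set C : {set T} | #|C :&: Z| == i]| * 2 ^ #|Z| = 'C(#|Z|, i) * 2 ^ #|T|)%N.
Proof.
pose D1 := [set A : {set T} | A \subset Z & #|A| == i].
pose D2 := powerset (~: Z).
pose h (p : {set T} * {set T}) := p.1 :|: p.2.
have capE A B : A \subset Z -> B \subset ~: Z -> (A :|: B) :&: Z = A.
  move=> sAZ sBZ; rewrite setIUl (setIidPl sAZ).
  have -> : B :&: Z = set0 by apply/eqP; rewrite setI_eq0 disjoints_subset.
  exact: setU0.
have diffE A B : A \subset Z -> B \subset ~: Z -> (A :|: B) :&: ~: Z = B.
  move=> sAZ sBZ; rewrite setIUl (setIidPl sBZ).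
  have -> : A :&: ~: Z = set0 by apply/eqP; rewrite setI_eq0 disjoints_subset setCK.
  exact: set0U.
have -> : [set C : {set T} | #|C :&: Z| == i] = h @: setX D1 D2.
  apply/setP => C; rewrite inE; apply/idP/imsetP => [hC|[[A B]]].
    exists (C :&: Z, C :&: ~: Z); last by rewrite /h /= -setIUr setUCr setIT.
    by rewrite !inE /= hC !subsetIr.
  rewrite !inE /= => /andP[/andP[sAZ /eqP <-] sB] ->.
  by rewrite /h /= capE.
rewrite card_in_imset; last first.
  move=> [A B] [A' B']; rewrite !inE /= => /andP[/andP[sAZ _] sB] /andP[/andP[sA'Z _] sB'].
  rewrite /h /= => e; congr pair.
    by rewrite -(capE A B) // e capE.
  by rewrite -(diffE A B) // e diffE.
rewrite cardsX cards_draws card_powerset -mulnA -expnD; congr (_ * 2 ^ _)%N.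
by rewrite addnC cardsC.
Qed.

(** Symmetric difference with [A] permutes the subsets: turning over some fair coins does not change
    the distribution of the number of heads. *)
Lemma card_shifted_draws A Z i :
  #|[set C : {set T} | #|[set a in Z | (a \in C) (+) (a \in A)]| == i]|
  = #|[set C : {set T} | #|C :&: Z| == i]|.
Proof.
pose h C := [set a | (a \in C) (+) (a \in A)].
have hK : involutive h by move=> C; apply/setP => a; rewrite !inE -addbA addbb addbF.
rewrite -(card_imset _ (inv_inj hK)); apply: eq_card => C.
rewrite !inE (can_imset_pre _ hK) !inE; congr (_ == _); apply: eq_card => a.
by rewrite !inE andbC -addbA addbb addbF.
Qed.

Lemma card_balanced_draws A B c :
  (#|A| <= #|B| + c)%N -> (#|B| <= #|A| + c)%N ->
  (2 ^ #|T| <= #|[set C : {set T} | #|C :&: A| == #|C :&: B|]|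
                * (2 ^ c * #|T|.+1))%N.
Proof.
(* With A and B made disjoint, C is balanced iff the symmetric difference of C
   and A meets their union in exactly #|A| points. *)
move=> leAB leBA; set A' := A :\: B; set B' := B :\: A; set Z := A' :|: B'.
have dAB : [disjoint A' & B'].
  by rewrite -setI_eq0; apply/eqP/setP => a; rewrite !inE; do !case: (_ \in _).
have cZ : #|Z| = (#|A'| + #|B'|)%N by rewrite cardsU (disjoint_setI0 dAB) cards0 subn0.
have e C : (#|C :&: A| == #|C :&: B|)
    = (#|[set a in Z | (a \in C) (+) (a \in A')]| == #|A'|).
  have -> : [set a in Z | (a \in C) (+) (a \in A')] = (A' :\: C) :|: (C :&: B').
    by apply/setP => a; rewrite !inE; do !case: (_ \in _).
  rewrite cardsU.
  have -> : #|(A' :\: C) :&: (C :&: B')| = 0%N.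
    by apply/eqP; rewrite cards_eq0; apply/eqP/setP => a; rewrite !inE; do !case: (_ \in _).
  have := cardsID B (C :&: A); have := cardsID A (C :&: B); have := cardsID C A'.
  have -> : A' :&: C = C :&: A :\: B by apply/setP => a; rewrite !inE; do !case: (_ \in _).
  have -> : C :&: B :\: A = C :&: B' by apply/setP => a; rewrite !inE; do !case: (_ \in _).
  have -> : C :&: B :&: A = C :&: A :&: B by apply/setP => a; rewrite !inE; do !case: (_ \in _).
  lia.
have -> : #|[set C : {set T} | #|C :&: A| == #|C :&: B|]|
        = #|[set C : {set T} | #|C :&: Z| == #|A'|]|.
  rewrite -(card_shifted_draws A'); apply: eq_card => C; by rewrite !inE e.
rewrite -(@leq_pmul2r (2 ^ #|Z|)) ?expn_gt0 // mulnAC card_capped_draws cZ.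
have le1 : (#|A'| <= #|B'| + c)%N.
  by have := cardsID B A; have := cardsID A B; rewrite setIC -/A' -/B'; lia.
have le2 : (#|B'| <= #|A'| + c)%N.
  by have := cardsID B A; have := cardsID A B; rewrite setIC -/A' -/B'; lia.
have := bin_near_central le1 le2; rewrite -cZ => h.
have hZ : (#|Z|.+1 <= #|T|.+1)%N by rewrite ltnS max_card.
rewrite [X in (X <= _)%N]mulnC mulnAC leq_mul2r; apply/orP; right.
apply: leq_trans h _; rewrite mulnC leq_mul2l; apply/orP; right.
by rewrite mulnC leq_mul2l hZ orbT.
Qed.

End Draws.

(** * Basic facts on neighbourhoods and degrees *)

Lemma nbrsC (T : finType) (G : sgraph T) u v : (u \in nbrs G v) = (v \in nbrs G u).
Proof. by have /andP[/forallP/(_ u)/forallP/(_ v)/eqP] := nbrsP G. Qed.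

Lemma nbrs_irr (T : finType) (G : sgraph T) v : (v \in nbrs G v) = false.
Proof. by have /andP[_ /forallP/(_ v)/negPf] := nbrsP G. Qed.

Lemma card_nbrs_regular (T : finType) d (G : sgraph T) v :
  G \in regular_graphs T d -> #|nbrs G v| = d.
Proof. by rewrite inE => /forallP/(_ v)/eqP. Qed.

Definition level_set (T : finType) (G : sgraph T) (S : {set T}) (D : nat) : {set T} :=
  [set w | #|S :&: nbrs G w| == D].

Lemma card_ffun_family (aT rT : finType) (F : aT -> {set rT}) :
  #|[set f : {ffun aT -> rT} | [forall a, f a \in F a]]| = \prod_a #|F a|.
Proof.
transitivity #|family F|; first by apply: eq_card => f; rewrite inE.
by rewrite card_family foldrE big_map big_enum.
Qed.

(** * Switching along disjoint pairs of vertices *)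

Section Switching.
(** The pairs are the two-element orbits of [iota], each with exactly one end in [S]; the fixed
    points are the vertices outside all pairs. *)
Variables (T : finType) (d : nat) (S : {set T}) (iota : T -> T).
Hypothesis iotaK : involutive iota.
Hypothesis iotaS : forall a, iota a != a -> (iota a \in S) = (a \notin S).
Implicit Types (G H : sgraph T) (M : {ffun T -> {set T}}).

Let moved : {set T} := [set a | iota a != a].
(* Both ends of a pair use the row of [M] indexed by the end lying in [S]. *)
Let rep a := if a \in S then a else iota a.
Let swap M u a := if (u \notin moved) && (u \in M (rep a)) then iota a else a.

Let moved_iota a : (iota a \in moved) = (a \in moved).
Proof. by rewrite !inE iotaK eq_sym. Qed.

Let rep_iota a : rep (iota a) = rep a.
Proof.
have [ea|/iotaS] := eqVneq (iota a) a; first by rewrite ea.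
by rewrite /rep; case: (a \in S) => /= ->; rewrite ?iotaK.
Qed.

Let swapK M u : involutive (swap M u).
Proof.
move=> a; rewrite {2}/swap; case: ifP => ua; last by rewrite /swap ua.
by rewrite /swap rep_iota ua iotaK.
Qed.

Let swap_iota M u a : swap M u (iota a) = iota (swap M u a).
Proof. by rewrite /swap rep_iota; case: ifP. Qed.

Let swap_out M u a : a \notin moved -> swap M u a = a.
Proof. by rewrite inE negbK => /eqP ea; rewrite /swap ea if_same. Qed.

Let swap_in M u a : u \in moved -> swap M u a = a.
Proof. by rewrite /swap => ->. Qed.

(** A moved [u] acts trivially on [v], and an unmoved [u] is fixed by every swap. This is what makes
    [flip M] an involution. *)
Let swap_swap M u v : swap M (swap M u v) (swap M v u) = u.
Proof.
case: (boolP (u \in moved)) => Pu; first by rewrite (swap_in _ _ Pu) swapK.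
by rewrite !(swap_out _ _ Pu).
Qed.

(* At a vertex [u] outside all pairs, [swap M u] exchanges the two ends of the
   pairs selected by [M].  Adjacencies between two moved vertices and between
   two unmoved ones are never altered. *)
Let flip_nbrs M G : {ffun T -> {set T}} :=
  [ffun v => [set u | swap M v u \in nbrs G (swap M u v)]].

Let flip_simple M G : simple_nbrs (flip_nbrs M G).
Proof.
apply/andP; split; last by apply/forallP => v; rewrite ffunE inE nbrs_irr.
by apply/forallP => u; apply/forallP => v; rewrite !ffunE !inE nbrsC.
Qed.

Let flip M G := SGraph (flip_simple M G).

Let flipE M G u v :
  (u \in nbrs (flip M G) v) = (swap M v u \in nbrs G (swap M u v)).
Proof. by rewrite /= ffunE inE. Qed.

Let flipK M : involutive (flip M).
Proof.
move=> G; apply: val_inj; apply/ffunP => v; apply/setP => u.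
by rewrite !flipE !swap_swap.
Qed.

(** At an unmoved vertex the neighbourhood is merely permuted. A moved vertex trades its neighbours
    in [R] for those of its partner in [R], so its degree survives when the two counts agree. *)
Let flip_regular G M :
    G \in regular_graphs T d ->
    (forall a, a \in S :&: moved ->
       #|M a :&: (nbrs G a :\: moved)| = #|M a :&: (nbrs G (iota a) :\: moved)|) ->
  flip M G \in regular_graphs T d.
Proof.
move=> rG balM; rewrite inE; apply/forallP => v; apply/eqP.
case: (boolP (v \in moved)) => Pv; last first.
  rewrite -(card_nbrs_regular v rG) -[RHS](card_preimset _ (inv_inj (swapK M v))).
  by apply: eq_card => u; rewrite flipE inE (swap_out _ _ Pv).
set R := M (rep v) :\: moved.
have -> : nbrs (flip M G) v = (nbrs G v :\: R) :|: (nbrs G (iota v) :&: R).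
  apply/setP => u; rewrite flipE (swap_in _ _ Pv) /swap !inE.
  by case: (u \in M _); case: (iota u == u) => /=; rewrite ?andbF ?andbT ?orbF.
have bal : #|nbrs G v :&: R| = #|nbrs G (iota v) :&: R|.
  have Jv : rep v \in S :&: moved.
    have ev : iota v != v by move: Pv; rewrite inE.
    rewrite in_setI /rep; case: ifP => Sv; first by rewrite Sv.
    by rewrite moved_iota Pv iotaS ?Sv.
  have e A : A :&: R = M (rep v) :&: (A :\: moved).
    by apply/setP => u; rewrite !inE; case: (iota u == u); do 2!case: (u \in _).
  have := balM _ Jv; rewrite !e /rep; case: ifP => // _ ->.
  by rewrite iotaK.
rewrite cardsU.
have -> : #|(nbrs G v :\: R) :&: (nbrs G (iota v) :&: R)| = 0.
  by apply/eqP; rewrite cards_eq0; apply/eqP/setP => u; rewrite !inE; case: (iota u == u); do 3!case: (u \in _).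
by rewrite subn0 -bal addnC cardsID (card_nbrs_regular v rG).
Qed.

(** The balance condition concerns each row of [M] separately and leaves the rows outside
    [S :&: moved] free, so the counts multiply over the rows. *)
Let card_regular_flips G :
  G \in regular_graphs T d ->
  ((2 ^ #|T|) ^ #|T| <= #|[set M | flip M G \in regular_graphs T d]|
     * (2 ^ #|moved| * #|T|.+1) ^ #|S :&: moved|)%N.
Proof.
move=> rG; set c := (2 ^ #|moved| * #|T|.+1)%N.
pose F a := if a \in S :&: moved then
   [set R : {set T} | #|R :&: (nbrs G a :\: moved)| == #|R :&: (nbrs G (iota a) :\: moved)|]
   else setT.
have sub : [set M : {ffun T -> {set T}} | [forall a, M a \in F a]]
    \subset [set M | flip M G \in regular_graphs T d].
  apply/subsetP => M; rewrite !inE => /forallP FM.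
  have : flip M G \in regular_graphs T d; last by rewrite inE.
  by apply: flip_regular => // a Ja; have := FM a; rewrite /F Ja inE => /eqP.
apply: leq_trans (leq_mul (subset_leq_card sub) (leqnn _)).
rewrite card_ffun_family.
have -> : (c ^ #|S :&: moved| = \prod_a (if a \in S :&: moved then c else 1))%N.
  by rewrite -big_mkcond prod_nat_const.
rewrite -[in X in (X <= _)%N]prod_nat_const -big_split /=; apply: leq_prod => a _.
rewrite /F; case: ifP => _; last by rewrite muln1 -cardsT -card_powerset powersetT cardsT.
(* Both ends have [d] neighbours in all, so after deletion of the moved vertices their counts differ
   by at most [#|moved|]. *)
apply: card_balanced_draws.
  have := cardsID moved (nbrs G a); have := cardsID moved (nbrs G (iota a)).
  have : (#|nbrs G (iota a) :&: moved| <= #|moved|)%N by rewrite subset_leq_card ?subsetIr.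
  rewrite !(card_nbrs_regular _ rG); lia.
have := cardsID moved (nbrs G a); have := cardsID moved (nbrs G (iota a)).
have : (#|nbrs G a :&: moved| <= #|moved|)%N by rewrite subset_leq_card ?subsetIr.
rewrite !(card_nbrs_regular _ rG); lia.
Qed.

Definition split_pairs G w := [set a in S | (a \in nbrs G w) != (iota a \in nbrs G w)].

(** Exchanging the two ends of a pair keeps exactly one of them adjacent to [w], so the supply of
    coins at [w] is the same before and after a flip. *)
Let split_pairs_flip M G w :
  w \notin moved -> split_pairs (flip M G) w = split_pairs G w.
Proof.
move=> Pw; apply/setP => a; rewrite 2!inE !flipE !(swap_out _ _ Pw) swap_iota.
by congr (_ && _); rewrite /swap; case: ifP; rewrite ?iotaK // eq_sym.
Qed.

(** Each split pair contributes a fair coin to the degree of [w] into [S], and the rest of [S]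
    contributes the constant [c0]; the spread of the binomial distribution then applies. *)
Let card_column_choices G w q K D :
    (forall k i, (K <= k)%N -> ('C(k, i) * 2 ^ q <= 2 ^ k)%N) ->
    (K <= #|split_pairs G w|)%N ->
  (#|[set C : {set T} | #|[set a in S | (if a \in C then iota a else a) \in nbrs G w]| == D]|
    * 2 ^ q <= 2 ^ #|T|)%N.
Proof.
move=> hK leK; set Z := split_pairs G w.
set c0 := #|[set a in S :\: Z | a \in nbrs G w]|.
have e C : #|[set a in S | (if a \in C then iota a else a) \in nbrs G w]|
   = (c0 + #|[set a in Z | (a \in C) (+) (a \in nbrs G w)]|)%N.
  rewrite -(cardsID Z) addnC; congr addn; apply: eq_card => a; rewrite !inE.
    by case: (a \in S) => //=; case: (a \in C); do 2!case: (_ \in nbrs _ _).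
  by case: (a \in S); rewrite ?andbF //=; case: (a \in C); do 2!case: (_ \in nbrs _ _).
set X := (X in (#|X| * _)%N).
(* Only an inclusion is needed, so the truncation in [D - c0] is harmless. *)
have sX : X \subset [set C : {set T} |
     #|[set a in Z | (a \in C) (+) (a \in nbrs G w)]| == (D - c0)%N].
  by apply/subsetP => C; rewrite !inE e => /eqP <-; rewrite addKn.
have := subset_leq_card sX; rewrite card_shifted_draws => leX.
rewrite -(@leq_pmul2r (2 ^ #|Z|)) ?expn_gt0 //.
apply: leq_trans (leq_mul (leq_mul leX (leqnn (2 ^ q))) (leqnn _)) _.
rewrite mulnAC card_capped_draws mulnAC [X in (_ <= X)%N]mulnC.
by rewrite leq_mul2r hK ?orbT.
Qed.

(** The exceptional set [E] is a fixed parameter, so that the degree condition constrains each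
    vertex outside [E] separately; the union bounds range over [E] later. *)
Definition stuck_graphs (E : {set T}) (D K L : nat) : {set sgraph T} :=
  [set G in regular_graphs T d |
     [forall w, (w \notin E) ==> (#|S :&: nbrs G w| == D)]
     && (L <= #|[set w in ~: (E :|: [set a | iota a != a]) | K <= #|split_pairs G w|]|)%N].

Let card_stuck_flips E D K L q H :
    (forall k i, (K <= k)%N -> ('C(k, i) * 2 ^ q <= 2 ^ k)%N) ->
  (#|[set M | flip M H \in stuck_graphs E D K L]| * 2 ^ (q * L) <= (2 ^ #|T|) ^ #|T|)%N.
Proof.
move=> hK; set X := [set M | _].
pose good := [set w in ~: (E :|: moved) | (K <= #|split_pairs H w|)%N].
case: (leqP L #|good|) => [leL | ltL]; last first.
  (* The set [good] is invariant under flips, so with fewer than [L] good vertices no flip of [H] is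
     stuck. *)
  suff -> : X = set0 by rewrite cards0 mul0n.
  apply/setP => M; rewrite !inE; apply/negP => /and3P[_ _].
  rewrite leqNgt => /negP; apply; apply: leq_ltn_trans ltL.
  apply: subset_leq_card; apply/subsetP => w; rewrite 2!inE [w \in good]inE => /andP[Pw].
  rewrite in_setC Pw /=.
  have Mw : w \notin moved by move: Pw; rewrite !inE negb_or => /andP[].
  by rewrite split_pairs_flip.
pose F w := if w \in good then
   [set C : {set T} | #|[set a in S | (if a \in C then iota a else a) \in nbrs H w]| == D]
   else setT.
(* Regularity is a condition on each row of [M], stuckness on each column. *)
pose col M : {ffun T -> {set T}} := [ffun w => [set a | w \in M a]].
have colK : involutive col.
  by move=> M; apply/ffunP => a; apply/setP => w; rewrite !ffunE !inE ffunE inE.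
have sub : col @: X \subset [set C : {ffun T -> {set T}} | [forall w, C w \in F w]].
  apply/subsetP => _ /imsetP[M + ->]; rewrite !inE => /and3P[_ /forallP degM _].
  apply/forallP => w; rewrite /F; case: ifP; last by rewrite inE.
  rewrite !inE negb_or -andbA => /and3P[Ew Pw _]; have := degM w; rewrite Ew /= => /eqP <-.
  apply/eqP/eq_card => a; rewrite ![in LHS]inE ffunE inE inE flipE.
  rewrite (swap_out _ _ (_ : w \notin moved)) ?inE //.
  by case Sa: (a \in S) => //=; rewrite /swap /rep Sa inE Pw.
have := subset_leq_card sub; rewrite card_imset ?card_ffun_family; last exact: inv_inj colK.
move=> leX; apply: leq_trans (leq_mul leX (_ : _ <= 2 ^ (q * #|good|))%N) _.
  by rewrite leq_exp2l // leq_mul2l leL orbT.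
have -> : (2 ^ (q * #|good|) = \prod_w (if w \in good then 2 ^ q else 1))%N.
  by rewrite -big_mkcond prod_nat_const expnM.
rewrite -big_split /= -[X in (_ <= X)%N]prod_nat_const; apply: leq_prod => w _.
rewrite /F; case: ifP => [|_]; last by rewrite muln1 -cardsT -card_powerset powersetT cardsT.
by rewrite inE => /andP[_ leK]; apply: card_column_choices hK leK.
Qed.

(* Double counting of the pairs (G, M) with G stuck and [flip M G] regular,
   using that [flip M] is an involution. *)
Lemma card_stuck_graphs E D K L q :
    (forall k i, (K <= k)%N -> ('C(k, i) * 2 ^ q <= 2 ^ k)%N) ->
  (#|stuck_graphs E D K L| * 2 ^ (q * L) <= #|regular_graphs T d|
     * (2 ^ #|[set a | iota a != a]| * #|T|.+1) ^ #|S :&: [set a | iota a != a]|)%N.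
Proof.
move=> hK; set B := stuck_graphs E D K L; set X := (X in (_ <= _ * X)%N).
set N := ((2 ^ #|T|) ^ #|T|)%N.
have N_gt0 : (0 < N)%N by rewrite !expn_gt0.
have cardE (A : {set sgraph T}) G :
    #|[set M | flip M G \in A]| = (\sum_M (flip M G \in A))%N.
  by rewrite -sum1_card big_mkcond /=; apply: eq_bigr => M _; rewrite inE; case: ifP.
have lower : (#|B| * N <= (\sum_(G in B) \sum_M (flip M G \in regular_graphs T d)) * X)%N.
  rewrite -sum_nat_const big_distrl /=; apply: leq_sum => G; rewrite inE => /andP[rG _].
  by rewrite -cardE; apply: card_regular_flips.
have upper : ((\sum_(H in regular_graphs T d) \sum_M (flip M H \in B)) * 2 ^ (q * L)
      <= #|regular_graphs T d| * N)%N.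
  rewrite -sum_nat_const big_distrl /=; apply: leq_sum => H _.
  by rewrite -cardE; apply: card_stuck_flips.
have swapsum : (\sum_(G in B) \sum_M (flip M G \in regular_graphs T d)
     = \sum_(H in regular_graphs T d) \sum_M (flip M H \in B))%N.
  rewrite exchange_big [RHS]exchange_big /=; apply: eq_bigr => M _.
  rewrite (reindex_inj (inv_inj (flipK M))) /= big_mkcond [RHS]big_mkcond.
  by apply: eq_bigr => H _; rewrite flipK; do 2!case: (_ \in _).
rewrite -(@leq_pmul2r N) // mulnAC.
apply: leq_trans (leq_mul lower (leqnn _)) _.
rewrite swapsum mulnAC [X in (_ <= X)%N]mulnAC leq_mul2r; apply/orP; right.
exact: upper.
Qed.

End Switching.

From mathcomp Require Import boolp reals sequences exp.

(** * Greedy choice of pairs that split many vertices *)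

Section RealEstimates.
Import Order.TTheory GRing.Theory Num.Theory.
Local Open Scope ring_scope.

Section Greedy.
Variables (R : realType) (T : finType) (split : T * T -> T -> bool).
Implicit Types (W S : {set T}) (A : {set T * T}).

Lemma exists_le_average (I : finType) (A : {set I}) (f : I -> R) c :
  (0 < #|A|)%N -> \sum_(i in A) f i <= c * #|A|%:R -> exists2 i, i \in A & f i <= c.
Proof.
move=> A_gt0 le_fc; have [//|noA] := pselect (exists2 i, i \in A & f i <= c).
have gtc i : i \in A -> c < f i.
  by move=> Ai; rewrite ltNge; apply/negP => le_fic; apply: noA; exists i.
exfalso; move: le_fc; apply/negP; rewrite -ltNge mulr_natr -sumr_const.
have /card_gt0P[i0 Ai0] := A_gt0.
apply: ltr_sum => //.
by apply/hasP; exists i0; rewrite ?mem_index_enum.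
Qed.

(** For a uniform pair from [A] the halving factor at [w] has mean at most 1 - q w / 2, hence at
    most the inverse of [expR (q w / 2)]. Some pair does no worse than the average. *)
Lemma exists_halving_pair W A (phi q : T -> R) :
    (forall w, 0 <= phi w) -> (0 < #|A|)%N ->
    (forall w, w \in W -> q w * #|A|%:R <= #|[set p in A | split p w]|%:R) ->
  exists2 p, p \in A &
    \sum_(w in W) phi w * expR (q w / 2) * 2^-1 ^+ split p w <= \sum_(w in W) phi w.
Proof.
move=> phi_ge0 A_gt0 le_q; apply: exists_le_average => //.
rewrite exchange_big mulr_suml; apply: ler_sum => w Ww.
rewrite -mulr_sumr.
have -> : \sum_(p in A) 2^-1 ^+ split p w
    = #|A|%:R - #|[set p in A | split p w]|%:R / 2 :> R.
  rewrite -!sum1_card !natr_sum mulr_suml.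
  rewrite [\sum_(i in [set _ in _ | _]) _](eq_bigl (fun p => (p \in A) && split p w));
    last by move=> p; rewrite inE.
  rewrite big_mkcondr /= -sumrB.
  by apply: eq_bigr => p _; case: (split p w); rewrite ?expr1 ?expr0 ?subr0 //; lra.
have h1 : #|A|%:R - #|[set p in A | split p w]|%:R / 2 <= #|A|%:R * expR (- (q w / 2)).
  have := le_q w Ww; have := expR_ge1Dx (- (q w / 2)).
  have : 0 < #|A|%:R :> R by rewrite ltr0n.
  move: (expR _) #|_|%:R #|_|%:R => e a b a_gt0 le_e le_qa; nra.
apply: le_trans (ler_wpM2l (mulr_ge0 (phi_ge0 w) (expR_ge0 _)) h1) _.
by rewrite -mulrA [expR _ * _]mulrCA -expRD subrr expR0 mulr1.
Qed.

(* The potential sums 2^-(number of chosen pairs splitting w), reweighted by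
   the expected decrease so that it never increases; pair [i] is taken from
   [Sb i] times the part of [~: S] that is still unused. *)
Lemma exists_halving_pairs (x0 : T) W S (Sb : nat -> {set T}) (q : nat -> T -> R) r :
    (r <= #|~: S|)%N ->
    (forall i, (i < r)%N -> (0 < #|Sb i|)%N) ->
    (forall i (U : {set T}) w, (i < r)%N -> w \in W -> U \subset ~: S -> (#|~: S| <= #|U| + r)%N ->
       q i w * #|setX (Sb i) U|%:R <= #|[set p in setX (Sb i) U | split p w]|%:R) ->
  forall j, (j <= r)%N -> exists p : nat -> T * T,
    [/\ forall i, (i < j)%N -> (p i).1 \in Sb i,
        forall i, (i < j)%N -> (p i).2 \notin S,
        forall i i', (i < j)%N -> (i' < j)%N -> (p i).2 = (p i').2 -> i = i'
      & \sum_(w in W) expR ((\sum_(i < j) q i w) / 2) * 2^-1 ^+ (\sum_(i < j) split (p i) w)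
          <= #|W|%:R].
Proof.
move=> le_r Sb_gt0 le_q; elim=> [|j IHj] lt_jr.
  exists (fun _ => (x0, x0)); split => //.
  rewrite -sumr_const; apply: ler_sum => w _.
  by rewrite !big_ord0 mul0r expR0 expr0 mulr1.
have [p [p1 p2 p_inj le_p]] := IHj (ltnW lt_jr).
set U := ~: S :\: [set (p i).2 | i : 'I_j].
have le_U : (#|~: S| <= #|U| + j)%N.
  have := cardsID [set (p i).2 | i : 'I_j] (~: S); rewrite -/U.
  have : (#|~: S :&: [set (p i).2 | i : 'I_j]| <= j)%N.
    apply: leq_trans (subset_leq_card (subsetIr _ _)) _.
    by apply: leq_trans (leq_imset_card _ _) _; rewrite card_ord.
  lia.
pose phi w := expR ((\sum_(i < j) q i w) / 2) * 2^-1 ^+ (\sum_(i < j) split (p i) w) : R.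
have phi_ge0 w : 0 <= phi w by rewrite mulr_ge0 ?expR_ge0 ?exprn_ge0 ?invr_ge0.
have [|w Ww|[x t]] := @exists_halving_pair W (setX (Sb j) U) phi (q j) phi_ge0.
- by rewrite cardsX muln_gt0 Sb_gt0 //=; lia.
- by apply: le_q => //; [rewrite subsetDl | lia].
rewrite !inE /= => /andP[Sx /andP[Ut St]] le_xt.
exists (fun i => if i == j then (x, t) else p i); split=> [i|i|i i'|].
- by rewrite ltnS leq_eqVlt; case: eqP => [-> _|_ /p1].
- by rewrite ltnS leq_eqVlt; case: eqP => [_ _|_ /p2].
- rewrite !ltnS (leq_eqVlt i) (leq_eqVlt i').
  case: eqP => [->|_] /=; case: eqP => [->|_] //= h h' e.
  + by case/imsetP: Ut; exists (Ordinal h').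
  + by case/imsetP: Ut; exists (Ordinal h).
  + exact: p_inj.
apply: le_trans le_p; apply: le_trans le_xt; apply: ler_sum => w _.
rewrite !big_ord_recr /= eqxx mulrDl expRD exprD.
rewrite [X in 2^-1 ^+ X](eq_bigr (fun i : 'I_j => split (p i) w : nat)); last first.
  by move=> i _; rewrite ltn_eqF.
rewrite le_eqVlt; apply/orP; left; apply/eqP; rewrite /phi; ring.
Qed.

End Greedy.

(** Elements go into blocks by the residue modulo [r] of their position in an enumeration of [S].
    Drawing first ends from disjoint blocks makes them distinct even if [S] has only [r] elements,
    while counts over the blocks still add up to counts over [S]. *)
Lemma exists_balanced_blocks (T : finType) (S : {set T}) r :
    (0 < r <= #|S|)%N ->
  exists Sb : nat -> {set T},
    [/\ forall i, (i < r)%N -> Sb i \subset S,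
        forall i, (i < r)%N -> (0 < #|Sb i|)%N /\ (#|Sb i| * r <= 2 * #|S|)%N,
        forall i j x, x \in Sb i -> x \in Sb j -> i = j
      & forall A : {set T}, (\sum_(i < r) #|Sb i :&: A| = #|S :&: A|)%N].
Proof.
case/andP=> r_gt0 le_r; pose idx x := index x (enum S).
have idx_lt x : x \in S -> (idx x < #|S|)%N.
  by rewrite -mem_enum -index_mem cardE.
exists (fun i => [set x in S | idx x %% r == i]%N); split=> [i _|i lt_ir|i j x|A].
- by apply/subsetP => x; rewrite inE => /andP[].
- split.
    have lt_iS : (i < size (enum S))%N by rewrite -cardE (leq_trans lt_ir).
    have [x0 _] := card_gt0P (leq_trans r_gt0 le_r).
    apply/card_gt0P; exists (nth x0 (enum S) i).
    by rewrite inE -mem_enum mem_nth //= /idx index_uniq ?enum_uniq // modn_small.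
  set B := [set x in S | _].
  suff : (#|B| <= (#|S| %/ r).+1)%N.
    move=> leB; apply: leq_trans (leq_mul leB (leqnn r)) _.
    by rewrite mulSn mul2n -addnn leq_add // leq_trunc_div.
  rewrite -[X in (_ <= X)%N]card_ord.
  rewrite -(@card_in_imset _ _ (fun x => inord (idx x %/ r) : 'I_(#|S| %/ r).+1)); first exact: max_card.
  move=> x y; rewrite !inE => /andP[Sx /eqP mx] /andP[Sy /eqP my] /(congr1 val).
  rewrite /= !inordK ?ltnS ?leq_div2r 1?ltnW ?idx_lt // => e.
  have : idx x = idx y by rewrite (divn_eq (idx x) r) (divn_eq (idx y) r) e mx my.
  by move/(congr1 (nth x (enum S))); rewrite !nth_index ?mem_enum.
- by rewrite !inE => /andP[_ /eqP <-] /andP[_ /eqP].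
rewrite -[RHS]sum1_card (partition_big (fun x => Ordinal (ltn_pmod (idx x) r_gt0)) predT) //=.
apply: eq_bigr => i _; rewrite -sum1_card; apply: eq_bigl => x.
by rewrite !inE -val_eqE /= -andbA [(_ == _) && _]andbC andbA.
Qed.

Lemma card_split_setX (T : finType) (A B N : {set T}) :
  #|[set p in setX A B | (p.1 \in N) != (p.2 \in N)]|
  = (#|A :&: N| * #|B :\: N| + #|A :\: N| * #|B :&: N|)%N.
Proof.
rewrite -!cardsX -[LHS](cardsID (setX N setT)); congr (_ + _)%N;
  apply: eq_card => -[a b]; rewrite !inE /= ?andbT; by do !case: (_ \in _).
Qed.

(* The right-hand side counts the pairs of S x ~S split by a d-set meeting S,
   of size s, in D points. *)
Lemma edge_split_bound (R : realFieldType) (n s d D : R) :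
    0 <= D -> 0 <= s -> 0 <= d -> 2 * s <= n -> 2 * d <= n ->
  s * d / 2 <= D * (n - s - d + D) + (s - D) * (d - D).
Proof.
move=> D0 s0 d0 sn dn.
suff : 0 <= s * d / 2 + D * (n - 2 * s - 2 * d + 2 * D) by move=> h; nra.
have [h|h] := leP 0 (n - 2 * s - 2 * d); first nra.
(* Now m = 2s + 2d - n is positive and at most n, so m^2 is at most nm, hence at most 4sd: the
   quadratic in [D] has discriminant at most 0. *)
have e : 0 <= (4 * D - (2 * s + 2 * d - n)) ^+ 2 by apply: sqr_ge0.
have f : (2 * s + 2 * d - n) ^+ 2 <= 4 * s * d.
  have : 0 <= (n - 2 * s) * (n - 2 * d) by apply: mulr_ge0; lra.
  have : 0 <= n * (2 * s + 2 * d - n) by apply: mulr_ge0; lra.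
  nra.
nra.
Qed.

Section Cover.
Variables (T : finType) (d : nat) (G : sgraph T).
Hypothesis rG : G \in regular_graphs T d.

Definition pair_split (p : T * T) w := (p.1 \in nbrs G w) != (p.2 \in nbrs G w).

(** The splitting fractions add up to at least 2(K + 1) at each [w], which gives [w] a weight of at
    least 2^(K + 1) in the potential. A vertex split fewer than [K] times then contributes at least
    2, while the whole potential is at most [#|W|]. *)
Lemma exists_spread_pairs (R : realType) (S : {set T}) (r D K : nat) :
    (0 < r <= #|S|)%N -> (2 * #|S| <= #|T|)%N -> (2 * d <= #|T|)%N ->
    (4 * r <= d)%N -> (16 * K.+1 * #|T| <= r * d)%N ->
    let W := level_set G S D in
    (0 < #|W|)%N ->
  exists p : 'I_r -> T * T,
    [/\ forall i, (p i).1 \in S, forall i, (p i).2 \notin S,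
        injective (fun i => (p i).1), injective (fun i => (p i).2)
      & (2 * #|[set w in W | (\sum_i pair_split (p i) w < K)%N]| <= #|W|)%N].
Proof.
move=> /[dup] hr /andP[r_gt0 le_rS] sn dn rd_small rd_big W.
have [Sb [SbS Sb_card Sb_inj Sb_sum]] := exists_balanced_blocks hr.
have [x0 _] := card_gt0P (leq_trans r_gt0 le_rS).
set n := #|T| in sn dn rd_big; set s := #|S| in sn le_rS hr Sb_card.
have cSC : #|~: S| = (n - s)%N by rewrite cardsCs setCK.
have n_gt0 : (0 < n)%N by lia.
move=> /card_gt0P[w0 Ww0].
have s_nat_gt0 : (0 < s)%N by apply: leq_trans le_rS.
have lt_sn : (s < n)%N by lia.
have s_gt0 : 0 < s%:R :> R by rewrite ltr0n.
have ns_gt0 : 0 < n%:R - s%:R :> R by rewrite subr_gt0 ltr_nat.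
have le_dn : (d - D <= n - s)%N by lia.
have le_Ds : (D <= s)%N.
  by move: Ww0; rewrite inE => /eqP <-; rewrite subset_leq_card ?subsetIl.
have le_Dd : (D <= d)%N.
  by move: Ww0; rewrite inE => /eqP <-; rewrite -(card_nbrs_regular w0 rG) subset_leq_card ?subsetIr.
(* A lower bound for the fraction of pairs from block [i] that split [w]: the terms [- r] allow for
   used vertices outside [S], and 2s(n - s)/r bounds the number of available pairs. *)
pose q i w : R := (#|Sb i :&: nbrs G w|%:R * (n%:R - s%:R - d%:R + D%:R - r%:R)
   + #|Sb i :\: nbrs G w|%:R * (d%:R - D%:R - r%:R)) * (r%:R / (2 * s%:R * (n%:R - s%:R))).
have degC w : w \in W -> #|~: S :&: nbrs G w| = (d - D)%N.
  rewrite inE => /eqP eD; have := cardsID S (nbrs G w).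
  by rewrite setIC eD (card_nbrs_regular w rG) setDE setIC; lia.
have [||i U w lt_ir Ww sU leU|p [p1 p2 p2_inj le_p]] :=
  @exists_halving_pairs R T pair_split x0 W S Sb q r _ _ _ r (leqnn r).
- lia.
- by move=> i /Sb_card[].
- have [Sbi_gt0 Sbi_le] := Sb_card i lt_ir.
  rewrite card_split_setX cardsX.
  have hUN := cardsID (nbrs G w) U.
  have hUd : (#|U :&: nbrs G w| <= d - D)%N.
    by rewrite -(degC w Ww) subset_leq_card // setSI.
  have hUn : (n - s - (d - D) <= #|U :\: nbrs G w| + r)%N by lia.
  have hUD : (d - D <= #|U :&: nbrs G w| + r)%N.
    have := subset_leq_card (setSD (nbrs G w) sU).
    by have := cardsID (nbrs G w) (~: S); rewrite degC //; lia.
  have hU : (#|U| <= n - s)%N by rewrite -cSC subset_leq_card.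
  have hA : #|Sb i|%:R * r%:R <= 2 * s%:R :> R by rewrite -!natrM ler_nat.
  move: hUn hUD hU; rewrite -!(ler_nat R) !natrD !natrM !natrB // 1?ltnW //.
  rewrite /q; set a : R := #|Sb i :&: _|%:R; set b : R := #|Sb i :\: _|%:R.
  set u := #|U :\: _|%:R; set v := #|U :&: _|%:R => hX hY hB.
  set rho := r%:R / _; rewrite -[X in X <= _]mulrA.
  have rho_ge0 : 0 <= rho * (#|Sb i|%:R * #|U|%:R).
    by rewrite /rho mulr_ge0 ?divr_ge0 ?mulr_ge0 ?ler0n // ltW.
  have rho_le1 : rho * (#|Sb i|%:R * #|U|%:R) <= 1.
    rewrite /rho mulrAC ler_pdivrMr ?mul1r ?mulr_gt0 //.
    by rewrite mulrA [_%:R * #|Sb i|%:R]mulrC ler_pM ?mulr_ge0 ?ler0n.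
  have a0 : 0 <= a by rewrite ler0n.
  have b0 : 0 <= b by rewrite ler0n.
  have u0 : 0 <= u by rewrite ler0n.
  have v0 : 0 <= v by rewrite ler0n.
  apply: le_trans (ler_wpM2r rho_ge0 (_ : _ <= a * u + b * v)) _.
    by apply: lerD; apply: ler_wpM2l => //; lra.
  by rewrite ler_piMr // addr_ge0 // mulr_ge0.
exists (fun i : 'I_r => p i); split=> /= [i|i|i j e|i j e|].
- by apply: (subsetP (SbS _ (ltn_ord i))); apply: p1.
- exact: p2 (ltn_ord i).
- by apply/val_inj/(Sb_inj _ _ (p i).1); [apply: p1 | rewrite e; apply: p1].
- exact: val_inj (p2_inj _ _ (ltn_ord i) (ltn_ord j) e).
(* Summed over the blocks, the first factor is the quantity of [edge_split_bound] minus rs, hence at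
   least sd/4 because 4r is at most d. *)
have q_big w : w \in W -> 2 * K.+1%:R <= \sum_(i < r) q i w.
  move=> Ww; rewrite /q -mulr_suml big_split /= -!mulr_suml -!natr_sum.
  rewrite Sb_sum (eq_bigr (fun i : 'I_r => #|Sb i :&: ~: nbrs G w|)); last first.
    by move=> i _; rewrite setDE.
  rewrite Sb_sum -setDE.
  have := cardsID (nbrs G w) S; have := Ww; rewrite inE => /eqP -> eS.
  have -> : #|S :\: nbrs G w| = (s - D)%N by rewrite /s -eS addKn.
  rewrite natrB //.
  rewrite mulrA ler_pdivlMr ?mulr_gt0 //.
  have := @edge_split_bound R n%:R s%:R d%:R D%:R.
  rewrite !ler0n -!natrM !ler_nat sn dn => /(_ isT isT isT isT isT).
  move: rd_small rd_big le_Ds; rewrite -!(ler_nat R) !natrM.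
  move: s_gt0 ns_gt0 {le_p}.
  have : 0 < r%:R :> R by rewrite ltr0n.
  have : 0 <= K.+1%:R :> R by rewrite ler0n.
  move: (s%:R) (r%:R) (d%:R) (n%:R) (D%:R) K.+1%:R => s' r' d' n' D' K' K0 r0 s0 ns0 h1 h2 h3 h4.
  have g1 : s' * d' / 4 <= D' * (n' - s' - d' + D' - r') + (s' - D') * (d' - D' - r').
    nra.
  have g2 : 16 * K' * (n' - s') <= r' * d' by have := mulr_ge0 K0 (ltW s0); nra.
  apply: le_trans (ler_wpM2r (ltW r0) g1).
  nra.
have exp_big w : w \in W -> 2 ^+ K.+1 <= expR ((\sum_(i < r) q i w) / 2) :> R.
  move=> /q_big le_q; apply: (@le_trans _ _ (expR K.+1%:R)).
    rewrite -[K.+1%:R]mulr1 expRM_natl lerXn2r ?nnegrE ?expR_ge0 //.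
    exact: le_trans (expR_ge1Dx 1).
  by rewrite ler_expR; lra.
rewrite -(ler_nat R) natrM; apply: le_trans le_p.
rewrite -sum1_card natr_sum mulr_sumr.
rewrite [X in _ <= X](bigID (fun w => (\sum_(i < r) pair_split (p i) w < K)%N)) /=.
rewrite ler_wpDr ?sumr_ge0 //; first by move=> w _; rewrite mulr_ge0 ?expR_ge0 ?exprn_ge0 ?invr_ge0.
rewrite [X in X <= _](eq_bigl (fun w => (w \in W) && (\sum_(i < r) pair_split (p i) w < K)%N)); last first.
  by move=> w; rewrite inE.
apply: ler_sum => w /andP[Ww lt_kK]; rewrite mulr1.
set k := (\sum_(i < r) _)%N in lt_kK *.
apply: le_trans (ler_wpM2r _ (exp_big w Ww)); last by rewrite exprn_ge0 ?invr_ge0.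
have lt_kK' : (k < K.+1)%N by rewrite ltnW.
rewrite exprVn -(expfB 2 lt_kK') -[X in X <= _](expr1 2).
by rewrite ler_weXn2l ?ler1n // subn_gt0.
Qed.

End Cover.

End RealEstimates.

(** * Union bound, and the involution given by a list of pairs *)

Lemma card_union_bound (T I : finType) (A : {set T}) (B : I -> {set T}) c e :
    (forall x, x \in A -> exists i, x \in B i) -> (forall i, #|B i| * c <= e)%N ->
  (#|A| * c <= #|I| * e)%N.
Proof.
move=> coverA leB; apply: (@leq_trans ((\sum_i #|B i|) * c)).
  rewrite leq_mul2r; apply/orP; right; rewrite -sum1_card.
  apply: (@leq_trans (\sum_(x in A) \sum_i (x \in B i))).
    apply: leq_sum => x /coverA[i Bix]; rewrite (bigD1 i) //= Bix; lia.
  rewrite exchange_big /=; apply: leq_sum => i _.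
  by rewrite -sum1_card big_mkcond [X in (_ <= X)%N]big_mkcond; apply: leq_sum => x _;
     do 2!case: (_ \in _).
rewrite big_distrl /= -sum_nat_const; apply: leq_sum => i _; exact: leB.
Qed.

Lemma leq_expW m n e : (m <= n -> m ^ e <= n ^ e)%N.
Proof. by case: e => // e le_mn; rewrite leq_exp2r. Qed.

Section Mate.
Variables (T : finType) (d r : nat) (S : {set T}) (p : 'I_r -> T * T).

Definition valid_pairs := [&& [forall i, (p i).1 \in S], [forall i, (p i).2 \notin S],
  injectiveb (fun i => (p i).1) & injectiveb (fun i => (p i).2)].

Definition mate a :=
  if [pick i | (p i).1 == a] is Some i then (p i).2
  else if [pick i | (p i).2 == a] is Some i then (p i).1 else a.

Hypothesis valid_p : valid_pairs.

Let p1S i : (p i).1 \in S.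
Proof. by case/and4P: valid_p => /forallP/(_ i). Qed.
Let p2S i : (p i).2 \notin S.
Proof. by case/and4P: valid_p => _ /forallP/(_ i). Qed.
Let p1_inj : injective (fun i => (p i).1).
Proof. by case/and4P: valid_p => _ _ /injectiveP h _. Qed.
Let p2_inj : injective (fun i => (p i).2).
Proof. by case/and4P: valid_p => _ _ _ /injectiveP. Qed.

Lemma mate1 i : mate (p i).1 = (p i).2.
Proof. by rewrite /mate; case: pickP => [j /eqP/p1_inj -> //|/(_ i)]; rewrite eqxx. Qed.

Lemma mate2 i : mate (p i).2 = (p i).1.
Proof.
rewrite /mate; case: pickP => [j /eqP e|_]; first by have := p2S i; rewrite -e p1S.
by case: pickP => [j /eqP/p2_inj -> //|/(_ i)]; rewrite eqxx.
Qed.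

Lemma mateP a : [\/ exists i, a = (p i).1, exists i, a = (p i).2 | mate a = a].
Proof.
rewrite /mate; case: pickP => [i /eqP <-|_]; first by constructor 1; exists i.
by case: pickP => [i /eqP <-|_]; [constructor 2; exists i | constructor 3].
Qed.

Lemma mateK : involutive mate.
Proof. by move=> a; case: (mateP a) => [[i ->]|[i ->]|ea]; rewrite ?(mate1, mate2) ?ea. Qed.

Lemma mate_side a : mate a != a -> (mate a \in S) = (a \notin S).
Proof.
case: (mateP a) => [[i ->]|[i ->]|->]; last by rewrite eqxx.
  by rewrite mate1 p1S (negPf (p2S i)).
by rewrite mate2 p1S p2S.
Qed.

Lemma moved_left : S :&: [set a | mate a != a] = [set (p i).1 | i : 'I_r].
Proof.
apply/setP => a; rewrite !inE; apply/andP/imsetP => [[Sa]|[i _ ->]].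
  case: (mateP a) => [[i ->] _|[i ea]|->]; [by exists i | | by rewrite eqxx].
  by have := p2S i; rewrite -ea Sa.
rewrite p1S mate1; split=> //; apply/eqP => e.
by have := p2S i; rewrite e p1S.
Qed.

Lemma card_moved_left : #|S :&: [set a | mate a != a]| = r.
Proof. by rewrite moved_left card_imset ?card_ord //; apply: p1_inj. Qed.

Lemma card_moved : (#|[set a | mate a != a]| <= 2 * r)%N.
Proof.
rewrite -(cardsID S) setIC card_moved_left mul2n -addnn leq_add2l.
rewrite -[X in (_ <= X)%N]card_ord -(card_imset _ p2_inj).
apply: subset_leq_card; apply/subsetP => a; rewrite !inE => /andP[Sa].
case: (mateP a) => [[i ea]|[i ->] _|->]; last by rewrite eqxx.
  by move: Sa; rewrite ea p1S.
by apply/imsetP; exists i.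
Qed.

Lemma card_split_pairs (G : sgraph T) w :
  #|split_pairs S mate G w| = (\sum_i pair_split G (p i) w)%N.
Proof.
have -> : split_pairs S mate G w = [set (p i).1 | i in [set i | pair_split G (p i) w]].
  apply/setP => a; rewrite inE; apply/andP/imsetP => [[Sa]|[i + ->]].
    case: (mateP a) => [[i ->]|[i ea]|->]; last by rewrite eqxx.
      by rewrite mate1 => spl; exists i; rewrite ?inE.
    by have := p2S i; rewrite -ea Sa.
  by rewrite inE => spl; rewrite p1S mate1.
rewrite card_imset; last exact: p1_inj.
by rewrite -sum1_card big_mkcond; apply: eq_bigr => i _; rewrite inE; case: ifP.
Qed.

Lemma card_stuck_pairs E D K L q :
    (forall k i, (K <= k)%N -> ('C(k, i) * 2 ^ q <= 2 ^ k)%N) ->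
  (#|stuck_graphs d S mate E D K L| * 2 ^ (q * L)
    <= #|regular_graphs T d| * (2 ^ (2 * r) * #|T|.+1) ^ r)%N.
Proof.
move=> hK; apply: leq_trans (card_stuck_graphs d mateK mate_side E D L hK) _.
rewrite leq_mul2l card_moved_left; apply/orP; right.
have leX : (2 ^ #|[set a | mate a != a]| * #|T|.+1 <= 2 ^ (2 * r) * #|T|.+1)%N.
  by rewrite leq_mul2r leq_exp2l ?card_moved ?orbT.
exact: leq_expW.
Qed.

End Mate.

(** * Counting graphs with large degree levels *)

Definition clustered_graphs (T : finType) (d r c : nat) : {set sgraph T} :=
  [set G in regular_graphs T d | [exists S : {set T}, exists D : 'I_#|T|.+1,
     [&& r <= #|S|, 2 * #|S| <= #|T| & #|T| < c * #|level_set G S D|]]]%N.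

Definition flat_graphs (T : finType) (d r : nat) : {set sgraph T} :=
  [set G in regular_graphs T d | [exists S : {set T}, exists D : 'I_#|T|.+1,
     [&& 0 < #|S|, #|S| < r & #|~: level_set G S D| < 2 * r]]]%N.

(** The union bound ranges over [S], the complement of the level set, the common degree and the [r]
    pairs, which accounts for the factors in front. *)
Lemma card_clustered (R : realType) (T : finType) (d r c K L q : nat) :
    (forall k i, (K <= k)%N -> ('C(k, i) * 2 ^ q <= 2 ^ k)%N) ->
    (0 < r)%N -> (2 * d <= #|T|)%N -> (4 * r <= d)%N ->
    (16 * K.+1 * #|T| <= r * d)%N -> (c * (2 * L + 4 * r) <= #|T|)%N ->
  (#|clustered_graphs T d r c| * 2 ^ (q * L)
    <= 2 ^ #|T| * 2 ^ #|T| * #|T|.+1 * (#|T| * #|T|) ^ r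
       * (#|regular_graphs T d| * (2 ^ (2 * r) * #|T|.+1) ^ r))%N.
Proof.
move=> hK r_gt0 dn rd_small rd_big hL.
pose B (x : {set T} * {set T} * 'I_#|T|.+1 * {ffun 'I_r -> T * T}) :=
  let: (A, E, D, p) := x in
  if valid_pairs A p then stuck_graphs d A (mate p) E D K L else set0.
have -> : (2 ^ #|T| * 2 ^ #|T| * #|T|.+1 * (#|T| * #|T|) ^ r =
   #|{: {set T} * {set T} * 'I_#|T|.+1 * {ffun 'I_r -> T * T}}|)%N.
  by rewrite !card_prod !card_ord card_ffun card_ord card_prod -!cardsT -powersetT card_powerset cardsT.
apply: (card_union_bound (B := B)) => [G|[[[S E] D] p]]; last first.
  by rewrite /B; case: ifP => [vp|_]; [apply: card_stuck_pairs | rewrite cards0].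
rewrite inE => /andP[rG /existsP[S /existsP[D /and3P[le_rS sn ltW]]]].
set W := level_set G S D in ltW.
have W_gt0 : (0 < #|W|)%N by case: (#|W|) ltW => //; rewrite muln0.
have hr : (0 < r <= #|S|)%N by rewrite r_gt0.
have [p [p1 p2 p1_inj p2_inj leB]] :=
  exists_spread_pairs rG R hr sn dn rd_small rd_big W_gt0.
pose p' := [ffun i => p i] : {ffun 'I_r -> T * T}.
exists (S, ~: W, D, p') => /=.
have vp : valid_pairs S p'.
  apply/and4P; split.
  - by apply/forallP => i; rewrite ffunE.
  - by apply/forallP => i; rewrite ffunE.
  - by apply/injectiveP => i j; rewrite !ffunE => /p1_inj.
  - by apply/injectiveP => i j; rewrite !ffunE => /p2_inj.
rewrite vp inE rG /=; apply/andP; split.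
  by apply/forallP => w; rewrite !inE negbK; apply/implyP.
set bad := [set w in W | _] in leB.
have sub : W :\: [set a | mate p' a != a] :\: bad \subset
    [set w in ~: (~: W :|: [set a | mate p' a != a]) | (K <= #|split_pairs S (mate p') G w|)%N].
  apply/subsetP => w /setDP[/setDP[Ww Mw]]; rewrite [w \in bad]inE Ww /= -leqNgt => leK.
  rewrite !inE in Ww Mw *; rewrite negb_or Mw negbK Ww /= card_split_pairs //.
  by apply: leq_trans leK _; apply: leq_sum => i _; rewrite ffunE.
apply: leq_trans (subset_leq_card sub).
have := card_moved vp; set M := [set a | _].
have h1 := cardsID M W; have h2 := cardsID bad (W :\: M).
have h3 : (#|W :&: M| <= #|M|)%N by rewrite subset_leq_card ?subsetIr.
have h4 : (#|(W :\: M) :&: bad| <= #|bad|)%N by rewrite subset_leq_card ?subsetIr.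
(* At most half of [W] is split too rarely and at most 2r of its members are moved, so this size
   leaves at least [L] vertices. *)
have h5 : (2 * L + 4 * r <= #|W|)%N.
  rewrite leqNgt; apply/negP => lt_W; move: ltW; rewrite ltnNge => /negP; apply.
  by apply: leq_trans hL; rewrite leq_mul2l (ltnW lt_W) orbT.
rewrite -/W in leB.
lia.
Qed.

(** The codegrees with [x] sum to d^2. If every [t] outside [S] failed, each would have codegree
    above 2d/3, and these more than 3n/4 vertices would already exceed that sum. *)
Lemma exists_far_vertex (T : finType) (d r : nat) (G : sgraph T) (S : {set T}) x :
    G \in regular_graphs T d -> (2 * d <= #|T|)%N -> (4 * r <= #|T|)%N -> (#|S| < r)%N ->
  exists2 t, t \notin S & (2 * d <= 3 * #|[set w | pair_split G (x, t) w]|)%N.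
Proof.
move=> rG dn rn lt_Sr.
have split_card t : (#|[set w | pair_split G (x, t) w]| + 2 * #|nbrs G x :&: nbrs G t| = 2 * d)%N.
  have -> : [set w | pair_split G (x, t) w] = (nbrs G x :\: nbrs G t) :|: (nbrs G t :\: nbrs G x).
    apply/setP => w; rewrite !inE /pair_split /= ![_ \in nbrs G w]nbrsC.
    by do 2!case: (_ \in _).
  have := cardsID (nbrs G t) (nbrs G x); have := cardsID (nbrs G x) (nbrs G t).
  rewrite !(card_nbrs_regular _ rG) cardsU [nbrs G t :&: _]setIC.
  have -> : #|(nbrs G x :\: nbrs G t) :&: (nbrs G t :\: nbrs G x)| = 0.
    by apply/eqP; rewrite cards_eq0; apply/eqP/setP => u; rewrite !inE; do 2!case: (u \in _).
  lia.
have sum_codeg : (\sum_t #|nbrs G x :&: nbrs G t| = d * d)%N.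
  have e t : #|nbrs G x :&: nbrs G t| = (\sum_(y in nbrs G x) (t \in nbrs G y))%N.
    rewrite -sum1_card [LHS]big_mkcond [RHS]big_mkcond; apply: eq_bigr => y _.
    by rewrite inE [y \in nbrs G t]nbrsC; do 2!case: (_ \in _).
  rewrite (eq_bigr _ (fun t _ => e t)) exchange_big /= -[X in (X * _)%N](card_nbrs_regular x rG).
  rewrite -sum_nat_const; apply: eq_bigr => y _.
  rewrite -(card_nbrs_regular y rG) -sum1_card [RHS]big_mkcond.
  by apply: eq_bigr => t _; case: (_ \in _).
case: (pickP [pred t | (t \notin S) && (2 * d <= 3 * #|[set w | pair_split G (x, t) w]|)%N]).
  by move=> t /andP[St far]; exists t.
move=> near; exfalso.
have close t : t \notin S -> ~~ (2 * d <= 3 * #|[set w | pair_split G (x, t) w]|)%N.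
  by move=> St; have := near t; rewrite /= St => /negbT.
have lb : ((#|T| - #|S|) * (2 * d).+1 <= 3 * (d * d))%N.
  have <- : #|~: S| = (#|T| - #|S|)%N by rewrite cardsCs setCK.
  rewrite -sum_codeg -sum_nat_const big_distrr /=.
  rewrite [X in (_ <= X)%N](bigID (fun t => t \notin S)) /=.
  apply: leq_trans (leq_addr _ _).
  rewrite (eq_bigl (fun t => t \notin S)); last by move=> t; rewrite inE.
  apply: leq_sum => t St; have := close t St; have := split_card t; lia.
nia.
Qed.

(** Both [S] and the exceptional set have fewer than 2r elements, so they are enumerated as images
    of short tuples, at a cost of n^(3r) instead of 4^n. One pair, giving one fair coin per split
    vertex, then suffices. *)
Lemma card_flat (T : finType) (d r L : nat) :
    (2 * d <= #|T|)%N -> (4 * r <= #|T|)%N -> (3 * (L + 2 * r + 2) <= 2 * d)%N ->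
  (#|flat_graphs T d r| * 2 ^ L
    <= #|T| ^ r * #|T| ^ (2 * r) * #|T|.+1 * (#|T| * #|T|)
       * (#|regular_graphs T d| * (2 ^ 2 * #|T|.+1)))%N.
Proof.
move=> dn rn hL.
pose img m (f : {ffun 'I_m -> T}) := [set f i | i : 'I_m].
have img_cover (x0 : T) m (A : {set T}) : x0 \in A -> (#|A| <= m)%N ->
    exists f : {ffun 'I_m -> T}, img m f = A.
  move=> Ax0 leA; exists [ffun i : 'I_m => nth x0 (enum A) i].
  apply/setP => x; apply/imsetP/idP => [[i _ ->]|Ax].
    rewrite ffunE; case: (ltnP i (size (enum A))) => [lt_i|ge_i].
      by rewrite -mem_enum mem_nth.
    by rewrite nth_default.
  have lt_x : (index x (enum A) < m)%N.
    by apply: leq_trans leA; rewrite cardE index_mem mem_enum.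
  by exists (Ordinal lt_x); rewrite // ffunE /= nth_index ?mem_enum.
pose B (x : {ffun 'I_r -> T} * {ffun 'I_(2 * r) -> T} * 'I_#|T|.+1 * {ffun 'I_1 -> T * T}) :=
  let: (f, g, D, p) := x in
  if valid_pairs (img _ f) p then stuck_graphs d (img _ f) (mate p) (img _ g) D 1 L else set0.
have -> : (#|T| ^ r * #|T| ^ (2 * r) * #|T|.+1 * (#|T| * #|T|) =
   #|{: {ffun 'I_r -> T} * {ffun 'I_(2 * r) -> T} * 'I_#|T|.+1 * {ffun 'I_1 -> T * T}}|)%N.
  by rewrite !card_prod !card_ord !card_ffun !card_ord card_prod expn1.
apply: (card_union_bound (B := B)) => [G|[[[f g] D] p]]; last first.
  rewrite /B; case: ifP => [vp|_]; last by rewrite cards0.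
  have := card_stuck_pairs d vp (img _ g) D L bin_spread1.
  by rewrite mul1n expn1.
rewrite inE => /andP[rG /existsP[S /existsP[D /and3P[S_gt0 lt_Sr ltE]]]].
have [x Sx] := card_gt0P S_gt0.
have [t St far] := exists_far_vertex x rG dn rn lt_Sr.
have [f fS] := img_cover x r S Sx (ltnW lt_Sr).
(* The exceptional set may be empty, which the image of a non-empty tuple is not, so only an
   inclusion is asked for. *)
have [g gE] : exists g : {ffun 'I_(2 * r) -> T}, ~: level_set G S D \subset img _ g.
  have [->|[y Ey]] := set_0Vmem (~: level_set G S D).
    by exists [ffun => x]; rewrite sub0set.
  by have [g <-] := img_cover y _ _ Ey (ltnW ltE); exists g.
exists (f, g, D, [ffun => (x, t)]) => /=; rewrite fS.
set p := [ffun => (x, t)].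
have vp : valid_pairs S p.
  apply/and4P; split; try by apply/forallP => i; rewrite ffunE.
  - by apply/injectiveP => i j _; rewrite !ord1.
  - by apply/injectiveP => i j _; rewrite !ord1.
rewrite vp inE rG /=; apply/andP; split.
  apply/forallP => w; apply/implyP; apply: contraR => degw.
  by apply: (subsetP gE); rewrite !inE.
set X := [set w | _] in far.
have sub : X :\: [set a | mate p a != a] :\: img _ g \subset
    [set w in ~: (img _ g :|: [set a | mate p a != a]) | (1 <= #|split_pairs S (mate p) G w|)%N].
  apply/subsetP => w /setDP[/setDP[Xw Mw] gw].
  rewrite inE in_setC in_setU negb_or gw Mw /= card_split_pairs // big_ord1 ffunE.
  by move: Xw; rewrite inE => ->.
apply: leq_trans (subset_leq_card sub).
have := card_moved vp; set M := [set a | _].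
have h1 := cardsID M X; have h2 := cardsID (img _ g) (X :\: M).
have h3 : (#|X :&: M| <= #|M|)%N by rewrite subset_leq_card ?subsetIr.
have h4 : (#|(X :\: M) :&: img _ g| <= 2 * r)%N.
  apply: leq_trans (subset_leq_card (subsetIr _ _)) _.
  by apply: leq_trans (leq_imset_card _ _) _; rewrite card_ord.
lia.
Qed.

(** * Choice of parameters and existence of regular graphs *)

Section Existence.
Import GRing.Theory.

Lemma leq_pow2_cancel a b x y l :
  (a * 2 ^ x <= b * 2 ^ y)%N -> (y + l <= x)%N -> (a * 2 ^ l <= b)%N.
Proof.
move=> le_ab le_x; rewrite -(@leq_pmul2r (2 ^ y)) ?expn_gt0 //.
apply: leq_trans le_ab; rewrite -mulnA -expnD leq_mul2l; apply/orP; right.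
by rewrite leq_exp2l // addnC.
Qed.

(** Since n + 1 is at most 2^l, every polynomial factor of the two union bounds becomes a power of
    2. The hypotheses leave [l] spare bits in each, so the bad fraction is at most 2 / 2^l. *)
Lemma card_bad_graphs (R : realType) (T : finType) (d r c K L q l : nat) :
    (forall k i, (K <= k)%N -> ('C(k, i) * 2 ^ q <= 2 ^ k)%N) ->
    (0 < r)%N -> (2 * d <= #|T|)%N -> (4 * r <= d)%N ->
    (16 * K.+1 * #|T| <= r * d)%N -> (c * (2 * L + 4 * r) <= #|T|)%N ->
    (#|T|.+1 <= 2 ^ l)%N -> (2 * #|T| + 2 * l + 3 * (l * r) + 2 * r ^ 2 <= q * L)%N ->
    (3 * (3 * (l * r) + 5 * l + 2 * r + 4) <= 2 * d)%N ->
  (#|clustered_graphs T d r c :|: flat_graphs T d r| * 2 ^ l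
     <= 2 * #|regular_graphs T d|)%N.
Proof.
move=> hK r_gt0 dn rd_small rd_big hL nl hq hd; set N := #|regular_graphs T d|.
have le_nl : (#|T| <= 2 ^ l)%N by apply: leq_trans nl.
have le_nnl : (#|T| * #|T| <= 2 ^ (2 * l))%N by rewrite mul2n -addnn expnD leq_mul.
have cl : (#|clustered_graphs T d r c| * 2 ^ l <= N)%N.
  apply: (@leq_pow2_cancel _ _ _ (2 * #|T| + l + 2 * l * r + (2 * r + l) * r)
    _ (leq_trans (card_clustered R hK r_gt0 dn rd_small rd_big hL) _)).
    rewrite mulnCA leq_mul2l; apply/orP; right.
    rewrite 3!expnD; apply: leq_mul; last by rewrite [X in (_ <= X)%N]expnM leq_expW // expnD leq_mul.
    apply: leq_mul; last by rewrite [X in (_ <= X)%N]expnM leq_expW.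
    by rewrite mul2n -addnn expnD; apply: leq_mul.
  by move: hq; rewrite -mulnn; lia.
have fl : (#|flat_graphs T d r| * 2 ^ l <= N)%N.
  have hL' : (3 * (3 * (l * r) + 5 * l + 2 + 2 * r + 2) <= 2 * d)%N by lia.
  have rn : (4 * r <= #|T|)%N by lia.
  apply: (@leq_pow2_cancel _ _ _ (l * r + l * (2 * r) + l + 2 * l + (2 + l))
    _ (leq_trans (card_flat dn rn hL') _)).
    rewrite mulnCA leq_mul2l; apply/orP; right.
    have nlX e : (#|T| ^ e <= 2 ^ (l * e))%N by rewrite expnM leq_expW.
    rewrite (expnD _ _ (2 + l)) (expnD _ _ (2 * l)) (expnD _ (_ + _) l) (expnD _ _ (l * (2 * r))) (expnD 2 2 l).
    exact: leq_mul (leq_mul (leq_mul (leq_mul (nlX r) (nlX _)) nl) le_nnl) (leq_mul (leqnn _) nl).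
  lia.
apply: leq_trans (leq_mul (leq_card_setU _ _).1 (leqnn _)) _.
by rewrite mulnDl mul2n -addnn leq_add.
Qed.

(** With q = 32c and [L] about n/(4c), the gain qL is about 8n and beats the 2n of the union bound.
    The value of [r], about 16(K + 1)n/d, is just enough for the splitting, and [A * l * n <= d ^ 2]
    makes lr a small fraction of d. *)
Lemma exists_parameters c : (0 < c)%N ->
  exists A, forall n d l, (2 * d <= n)%N -> (n.+1 <= 2 ^ l)%N -> (0 < n)%N ->
    (A * l * n <= d ^ 2)%N ->
  exists r K L q, (forall k i, (K <= k)%N -> ('C(k, i) * 2 ^ q <= 2 ^ k)%N) /\
    [/\ [/\ (0 < r)%N, (4 * r <= d)%N & (c <= n)%N],
        (16 * K.+1 * n <= r * d)%N, (c * (2 * L + 4 * r) <= n)%N,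
        (2 * n + 2 * l + 3 * (l * r) + 2 * r ^ 2 <= q * L)%N
      & (3 * (3 * (l * r) + 5 * l + 2 * r + 4) <= 2 * d)%N].
Proof.
move=> c_gt0; have [K hK] := bin_spread (32 * c).
pose B := (16 * K.+1 + 1 + c)%N; exists (100 * B ^ 2)%N => n d l dn nl n_gt0 hd.
have l_gt0 : (0 < l)%N by case: l nl {hd}; lia.
have c_le_B : (c <= B)%N by rewrite /B leq_addl.
have B_gt0 : (0 < B)%N by apply: leq_trans c_le_B.
have d_gt0 : (0 < d)%N.
  rewrite -sqrn_gt0; apply: leq_trans hd.
  by rewrite !muln_gt0 B_gt0 l_gt0 n_gt0.
pose r := (16 * K.+1 * n %/ d).+1.
have rd_big : (16 * K.+1 * n <= r * d)%N by rewrite ltnW // ltn_ceil.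
have rd_up : (r * d <= B * n)%N.
  rewrite mulSn; apply: leq_trans (leq_add (_ : d <= n) (leq_trunc_div _ _))%N _; first lia.
  by rewrite /B; nia.
have r_gt0 : (0 < r)%N by [].
clearbody r B.
have lr : (100 * B * (l * r) <= d)%N.
  rewrite -(@leq_pmul2r d) // mulnn; apply: leq_trans hd.
  have -> : (100 * B * (l * r) * d = 100 * B * l * (r * d))%N by lia.
  have -> : (100 * B ^ 2 * l * n = 100 * B * l * (B * n))%N by rewrite -mulnn; lia.
  by rewrite leq_mul2l rd_up orbT.
have lr1 : (100 * (l * r) <= d)%N by apply: leq_trans lr; rewrite leq_mul2r leq_pmulr ?orbT.
have rl : (r <= l * r)%N by rewrite leq_pmull.
have ll : (l <= l * r)%N by rewrite leq_pmulr.
have cr : (100 * (c * r) <= d)%N.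
  by apply: leq_trans lr; rewrite -mulnA leq_mul2l /= leq_mul.
have rr : (100 * r ^ 2 <= n)%N.
  rewrite -(@leq_pmul2l B) //; apply: leq_trans rd_up.
  have -> : (B * (100 * r ^ 2) = r * (100 * B * r))%N by rewrite -mulnn; lia.
  by rewrite leq_mul2l; apply/orP; right; apply: leq_trans lr; rewrite leq_mul2l rl orbT.
have c_le : (c <= c * r)%N by rewrite leq_pmulr.
pose L := (n %/ (4 * c))%N.
have L1 : (4 * (c * L) <= n)%N by rewrite mulnA mulnC leq_trunc_div.
have L2 : (n < 4 * (c * L) + 4 * c)%N.
  have := ltn_ceil n (_ : 0 < 4 * c)%N; rewrite -/L muln_gt0 => /(_ c_gt0); nia.
exists r, K, L, (32 * c)%N; split=> //; split=> //.
- by split=> //; lia.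
- by rewrite mulnDr !(mulnCA c); lia.
- rewrite -mulnA; lia.
lia.
Qed.

(** A circulant graph on the cyclic group: differences up to [d./2] in either direction, together
    with the antipode for odd [d]. This keeps the probability from being the default value 0. *)
Lemma exists_regular_graph n d :
  (0 < n)%N -> (2 * d <= n)%N -> ~~ odd (d * n) -> (0 < #|regular_graphs 'I_n d|)%N.
Proof.
case: n => // n _ dn dn_even; set m := d./2.
have md : (d = odd d + m.*2)%N by rewrite odd_double_half.
pose D0 := [set x : 'I_n.+1 | (0 < x)%N && ((x <= m) || (n.+1 <= x + m))%N].
have D0card : #|D0| = m.*2.
  rewrite -sum1dep_card big_mkcond /= -(big_mkord xpredT
    (fun x => if (0 < x)%N && ((x <= m) || (n.+1 <= x + m))%N then 1 else 0)%N).
  rewrite (@big_cat_nat _ _ _ 1) //= (@big_cat_nat _ _ _ m.+1 1) //=; try lia.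
  rewrite (@big_cat_nat _ _ _ (n.+1 - m) m.+1) //=; try lia.
  rewrite big_nat1 /= (eq_big_nat _ _ (F2 := fun=> 1%N)) => [|i hi]; last by case: ifP => //; lia.
  rewrite [X in (_ + (_ + (X + _)))%N]big_nat_cond [X in (_ + (_ + (X + _)))%N]big1; last first.
    by move=> i hi; case: ifP => //; lia.
  rewrite [X in (_ + (_ + (_ + X)))%N](eq_big_nat _ _ (F2 := fun=> 1%N)) => [|i hi];
    last by case: ifP => //; lia.
  by rewrite !sum_nat_const_nat; lia.
have valN (x : 'I_n.+1) : val (- x)%R = ((n.+1 - x) %% n.+1)%N by [].
have D0N x : (- x \in D0)%R = (x \in D0).
  rewrite !inE valN; case: (posnP x) => [->|x_gt0]; first by rewrite subn0 modnn.
  by have := ltn_ord x => ?; rewrite modn_small; lia.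
(* For odd [d] the parity hypothesis makes the number of vertices even, so [h] is the element of
   order two and is its own negative. *)
pose h : 'I_n.+1 := inord n.+1./2.
pose D := if odd d then h |: D0 else D0.
have odd_h : odd d -> [/\ val h = n.+1./2, (n.+1./2).*2 = n.+1 & h \notin D0].
  move=> od; have en : ~~ odd n.+1 by move: dn_even; rewrite oddM od.
  have e2 : ((n.+1./2).*2 = n.+1)%N by rewrite even_halfK.
  have eh : val h = n.+1./2 by rewrite /h /= inordK //; lia.
  split=> //; rewrite inE -[nat_of_ord h]/(val h) eh; lia.
have DN x : (- x \in D)%R = (x \in D).
  rewrite /D; case: ifP => [od|_]; last exact: D0N.
  have [eh e2 _] := odd_h od; rewrite !in_setU1 D0N; congr (_ || _).
  rewrite -!val_eqE valN eh; have := ltn_ord x => ?.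
  case: (posnP x) => [x0|x_gt0]; first by rewrite /= x0 subn0 modnn.
  by rewrite modn_small /=; lia.
have D_0 : (0 : 'I_n.+1)%R \notin D.
  rewrite /D; case: ifP => [/odd_h[eh e2 _]|_]; last by rewrite inE.
  by rewrite in_setU1 negb_or inE /= andbT -val_eqE eh /=; lia.
have Dcard : #|D| = d.
  rewrite [RHS]md /D; case: ifP => [od|_]; last by rewrite D0card.
  by have [_ _ hD] := odd_h od; rewrite cardsU1 hD D0card.
pose N : {ffun 'I_n.+1 -> {set 'I_n.+1}} := [ffun u => [set v | (v - u)%R \in D]].
have Nsimple : simple_nbrs N.
  apply/andP; split; last by apply/forallP => v; rewrite ffunE inE subrr.
  by apply/forallP => u; apply/forallP => v; rewrite !ffunE !inE -opprB DN.
apply/card_gt0P; exists (SGraph Nsimple); rewrite inE; apply/forallP => v; apply/eqP.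
rewrite /= ffunE -Dcard -[RHS](card_imset _ (addIr v)); apply: eq_card => u.
rewrite inE; apply/idP/imsetP => [Du | [x Dx ->]]; last by rewrite addrK.
by exists (u - v)%R; rewrite ?subrK.
Qed.

End Existence.

(* Colour classes after two rounds of refinement *)
From mathcomp Require Import finmap multiset.

(** Membership in [X] is a property of the colour, namely [a], so the number of neighbours in [X]
    can be read off from the multiset of their colours. *)
Lemma refine_colouring_count (T : finType) (K : choiceType) (G : sgraph T) (C : T -> K)
    (X : {set T}) v v' :
    (forall w w', C w = C w' -> (w \in X) = (w' \in X)) ->
    refine_colouring G C v = refine_colouring G C v' ->
  #|X :&: nbrs G v| = #|X :&: nbrs G v'|.
Proof.
move=> XC [_ /eq_seq_msetP /permP eC].
pose a k := [exists w, (w \in X) && (C w == k)].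
have aC w : a (C w) = (w \in X).
  apply/existsP/idP => [[u /andP[Xu /eqP/XC <-]] // | Xw].
  by exists w; rewrite Xw eqxx.
have cnt u : #|X :&: nbrs G u| = count a [seq C w | w <- enum (nbrs G u)].
  rewrite count_map (eq_count aC) -size_filter cardE /enum_mem -filter_predI.
  by congr size; apply: eq_filter => w; rewrite !inE.
by rewrite !cnt eC.
Qed.

(** A set larger than half is replaced by its complement: in a regular graph the degree [D] into [X]
    corresponds to the degree [d - D] into [~: X]. *)
Lemma level_set_bound (T : finType) (d r c : nat) (G : sgraph T) (X : {set T}) D :
    G \in regular_graphs T d -> G \notin clustered_graphs T d r c ->
    (r <= #|X|)%N -> (#|X| + r <= #|T|)%N ->
  (c * #|level_set G X D| <= #|T|)%N.
Proof.
move=> rG clG rX Xr; move: clG; rewrite inE rG /= negb_exists => /forallP noX.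
have small (Y : {set T}) E : (r <= #|Y|)%N -> (2 * #|Y| <= #|T|)%N -> (c * #|level_set G Y E| <= #|T|)%N.
  (* Degrees beyond the range of the ordinal in [clustered_graphs] have empty level sets. *)
  move=> rY Yn; case: (ltnP #|T| E) => [lt_nE | le_En].
    have -> : level_set G Y E = set0.
      apply/setP => w; rewrite !inE; apply/negP => /eqP eE; move: lt_nE.
      by rewrite -eE ltnNge max_card.
    by rewrite cards0 muln0.
  have := noX Y; rewrite negb_exists => /forallP/(_ (inord E)).
  by rewrite inordK // rY Yn /= -leqNgt.
case: (leqP (2 * #|X|) #|T|) => [|Xn]; first exact: small.
have cX := cardsC X.
have rX' : (r <= #|~: X|)%N by lia.
have Xn' : (2 * #|~: X| <= #|T|)%N by lia.
apply: leq_trans (small (~: X) (d - D)%N rX' Xn').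
rewrite leq_mul2l; apply/orP; right; apply: subset_leq_card.
apply/subsetP => w; rewrite !inE => /eqP eD; apply/eqP.
have := cardsID X (nbrs G w); rewrite (card_nbrs_regular w rG) setIC eD setDE setIC; lia.
Qed.

Lemma exists_medium_cut (T : finType) (d r : nat) (G : sgraph T) (S : {set T}) :
    G \in regular_graphs T d -> G \notin flat_graphs T d r ->
    (0 < #|S| < r)%N -> (2 * r <= #|T|)%N ->
  exists D, let Q := [set w | #|S :&: nbrs G w| <= D]%N in
    (r <= #|Q|)%N /\ (#|Q| + r <= #|T|)%N.
Proof.
move=> rG flG /andP[S_gt0 lt_Sr] rn; move: flG; rewrite inE rG /= negb_exists => /forallP/(_ S).
rewrite negb_exists => /forallP noD.
pose F D := #|[set w | #|S :&: nbrs G w| <= D]%N|.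
have Fn : (r <= F #|T|)%N.
  apply: leq_trans (_ : #|T| <= _)%N; first by lia.
  rewrite -cardsT /F; apply/subset_leq_card/subsetP => w _; rewrite inE; exact: subset_leq_card (subsetT _).
have exF : exists D, (r <= F D)%N by exists #|T|.
(* If the first large sublevel set were too large, a single level would
   contain all but fewer than 2r vertices. *)
case: (ex_minnP exF) => D rF minD.
exists D; split => //; rewrite -/(F D).
have le_Dn : (D < #|T|.+1)%N by rewrite ltnS minD.
have := noD (Ordinal le_Dn); rewrite /= S_gt0 lt_Sr /= -leqNgt.
have sub : ~: level_set G S D \subset
    [set w | (#|S :&: nbrs G w| < D)%N] :|: ~: [set w | #|S :&: nbrs G w| <= D]%N.
  by apply/subsetP => w; rewrite !inE -ltnNge neq_ltn.
have lowF : (#|[set w | (#|S :&: nbrs G w| < D)%N]| <= r.-1)%N.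
  case: D minD {rF le_Dn noD sub} => [|D] minD.
    by rewrite (_ : [set w | _] = set0) ?cards0 //; apply/setP => w; rewrite !inE ltn0.
  have : (F D < r)%N by rewrite ltnNge; apply/negP => /minD; rewrite ltnn.
  by rewrite -[#|_|]/(F D); lia.
have cQ := cardsC [set w | #|S :&: nbrs G w| <= D]%N; rewrite -/(F D) in cQ.
have := leq_trans (subset_leq_card sub) (leq_card_setU _ _).1.
move: lowF cQ (leq_ltn_trans S_gt0 lt_Sr).
move: #|[set w | (_ < D)%N]| (F D) #|~: [set _ | _]| #|~: level_set G S D| #|T|; lia.
Qed.

Lemma colour_class_bound (T : finType) (d r c : nat) (G : sgraph T) (V1 V2 : {set T}) v :
    G \in regular_graphs T d -> G \notin clustered_graphs T d r c ->
    G \notin flat_graphs T d r -> (2 * r <= #|T|)%N ->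
    nontrivial_bipartition V1 V2 ->
  (c * #|[set w | refine_colouring G (refine_colouring G (two_part_colouring V1)) v
                  == refine_colouring G (refine_colouring G (two_part_colouring V1)) w]|
     <= #|T|)%N.
Proof.
move=> rG clG flG rn [V1n0 V2n0 dV cV]; set C0 := two_part_colouring V1.
set C1 := refine_colouring G C0; set C := refine_colouring G C1.
have V2E : V2 = ~: V1.
  apply/setP => w; have /setP/(_ w) := dV; have /setP/(_ w) := cV.
  by rewrite !inE; do 2!case: (_ \in _).
have by_cut (X : {set T}) : (forall w w', C1 w = C1 w' -> (w \in X) = (w' \in X)) ->
    (r <= #|X|)%N -> (#|X| + r <= #|T|)%N -> (c * #|[set w | C v == C w]| <= #|T|)%N.
  move=> XC rX Xr; apply: leq_trans (level_set_bound #|X :&: nbrs G v| rG clG rX Xr).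
  rewrite leq_mul2l; apply/orP; right; apply: subset_leq_card; apply/subsetP => w.
  by rewrite !inE => /eqP eC; rewrite (refine_colouring_count XC eC).
have C0V w w' : C0 w = C0 w' -> (w \in V1) = (w' \in V1).
  by rewrite /C0 /two_part_colouring; do 2!case: (_ \in V1).
have [S0 [S0C S0_gt0 S0n]] : exists S0 : {set T},
    [/\ forall w w', C0 w = C0 w' -> (w \in S0) = (w' \in S0), 0 < #|S0| & 2 * #|S0| <= #|T|]%N.
  have cV1 := cardsC V1;
  case: (leqP (2 * #|V1|) #|T|) => V1n.
    by exists V1; rewrite card_gt0.
  exists V2; split; [|by rewrite card_gt0|by rewrite V2E; lia].
  by move=> w w' /C0V; rewrite V2E !inE => ->.
(* The colouring [C1] refines [C0], so a large [S0] can serve as the cut itself; otherwise a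
   sublevel set of the degree into [S0], visible in [C1], is used. *)
case: (leqP r #|S0|) => [rS0|S0r].
  by apply: (by_cut S0) => //; [move=> w w' [/S0C] | lia].
have hS0 : (0 < #|S0| < r)%N by rewrite S0_gt0.
have [D [rQ Qr]] := exists_medium_cut rG flG hS0 rn.
apply: by_cut rQ Qr => w w' eC1.
by rewrite !inE (refine_colouring_count S0C eC1).
Qed.

(** * Packing small colour classes into balanced unions *)

Lemma exists_subfamily (I : finType) (w : I -> nat) (U : {set I}) a s :
    (forall A, A \in U -> w A <= s)%N -> (a <= \sum_(A in U) w A)%N ->
  exists Q : {set I}, [/\ Q \subset U, (a <= \sum_(A in Q) w A)%N
     & (\sum_(A in Q) w A <= a + s)%N].
Proof.
move=> ws aU.
pose P (Q : {set I}) := (Q \subset U) && (a <= \sum_(A in Q) w A)%N.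
have PU : P U by rewrite /P subxx.
(* In a subfamily of least cardinality, removing any member drops the total below [a], so the
   overshoot is at most one weight. *)
case: (arg_minnP (fun Q : {set I} => #|Q|) PU) => Q /andP[QU aQ] minQ.
exists Q; split=> //; have [->|[A QA]] := set_0Vmem Q; first by rewrite big_set0.
rewrite (big_setD1 A) //= addnC leq_add ?ws ?(subsetP QU) // leqNgt; apply/negP => ltD.
have /minQ : P (Q :\ A).
  by rewrite /P (ltnW ltD) (subset_trans (subD1set Q A) QU).
by rewrite (cardsD1 A Q) QA ltnn.
Qed.

(** Bins are filled one after another; each takes at most [a + s], so enough weight is left for the
    others. Items with a value of at least [k] stay unassigned. *)
Lemma exists_bins (I : finType) (w : I -> nat) (U : {set I}) a s k :
    (forall A, A \in U -> w A <= s)%N -> (k * (a + s) <= \sum_(A in U) w A)%N ->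
  exists f : I -> nat, forall i, (i < k)%N ->
    (a <= \sum_(A in U | f A == i) w A <= a + s)%N.
Proof.
elim: k U => [|k IHk] U ws kU; first by exists (fun _ => 0%N).
have [|Q [QU aQ Qs]] := @exists_subfamily _ w U a s ws; first nia.
have [||f fk] := IHk (U :\: Q).
- by move=> A /setDP[/ws].
- by move: kU; rewrite (big_setID Q) /= (setIidPr QU); lia.
exists (fun A => if A \in Q then 0%N else (f A).+1) => -[_|i /fk].
  rewrite (eq_bigl (fun A => A \in Q)) ?aQ // => A.
  by case: ifP => [/(subsetP QU) -> | _]; rewrite ?andbF.
rewrite (eq_bigl (fun A => (A \in U) && ((if A \in Q then 0%N else (f A).+1) == i.+1))) //.
by move=> A; rewrite inE; case: (A \in Q); rewrite ?andbF.
Qed.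

(** The first k - 1 bins overshoot by at most n/(4k) in total, so the last bin, which receives the
    remaining n - t, is also of size about n/k. *)
Lemma bin_size_arith n k a s t :
    (0 < k)%N -> (4 * k ^ 2 <= n)%N -> a = (n %/ k)%N -> (4 * k ^ 2 * s <= n)%N ->
  [/\ (k.-1 * (a + s) <= n)%N,
      (a <= t <= a + s)%N -> (n <= 3 * k * t)%N /\ (k * t <= 3 * n)%N
    & (k.-1 * a <= t <= k.-1 * (a + s))%N ->
      (n <= 3 * k * (n - t))%N /\ (k * (n - t) <= 3 * n)%N].
Proof.
case: k => // k _ hk ea hs /=; rewrite -mulnn in hk hs.
have := ltn_ceil n (ltn0Sn k); have := leq_trunc_div n k.+1; rewrite -ea => h1 h2 {ea}.
have h3 : (4 * (k.+1 * s) <= n)%N by nia.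
have h4 : (4 * (k.+1 * (k * s)) <= n)%N by nia.
have h5 : (k.+1 * (k * a) <= k * n)%N by nia.
have h6 : (k * n <= k.+1 * (k * a) + k * k.+1)%N by nia.
have e1 : (k * (a + s) <= n)%N.
  by rewrite -(@leq_pmul2l k.+1) // !mulnDr (mulSn k n); lia.
split=> // /andP[t1 t2]; split.
- by apply: leq_trans (_ : 3 * k.+1 * a <= _)%N; [nia | rewrite leq_mul2l t1 orbT].
- by apply: leq_trans (_ : k.+1 * (a + s) <= _)%N; [rewrite leq_mul2l t2 orbT | nia].
- have : (k.+1 * t <= k.+1 * (k * a) + k.+1 * (k * s))%N.
    by rewrite -!mulnDr leq_mul2l t2 orbT.
  by rewrite mulnBr -!mulnA (mulSn k n) => h; lia.
have : (k.+1 * (k * a) <= k.+1 * t)%N by rewrite leq_mul2l t1 orbT.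
by rewrite mulnBr (mulSn k n); lia.
Qed.

Lemma exists_balanced_union (T : finType) (K : choiceType) (C : T -> K) k :
    (0 < k)%N -> (4 * k ^ 2 <= #|T|)%N ->
    (forall v, 4 * k ^ 2 * #|[set w | C v == C w]| <= #|T|)%N ->
  exists W : 'I_k -> {set T},
    partition_family W /\
    forall i : 'I_k, [/\ (#|T| <= 3 * k * #|W i|)%N, (k * #|W i| <= 3 * #|T|)%N
       & union_of_colour_classes C (W i)].
Proof.
case: k => // k _ hk class_le; set U := colour_classes C.
have [/eqP coverU tiU _] := and3P (preim_partitionP C setT).
rewrite -[preim_partition C setT]/U in coverU tiU.
set s := (#|T| %/ (4 * k.+1 ^ 2))%N.
have ws A : A \in U -> (#|A| <= s)%N.
  case/imsetP => v _ ->; rewrite leq_divRL ?muln_gt0 ?expn_gt0 // mulnC.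
  apply: leq_trans (class_le v); rewrite leq_mul2l; apply/orP; right.
  by apply: subset_leq_card; apply/subsetP => w; rewrite !inE.
have hs : (4 * k.+1 ^ 2 * s <= #|T|)%N by rewrite mulnC leq_trunc_div.
have sumU : \sum_(A in U) #|A| = #|T| by rewrite (eqP tiU) coverU cardsT.
set a := (#|T| %/ k.+1)%N.
have arith t := @bin_size_arith #|T| k.+1 a s t (ltn0Sn k) hk (erefl _) hs.
have [|f fP] := @exists_bins _ (fun A : {set T} => #|A|) U a s k ws.
  by rewrite sumU; case: (arith 0%N).
(* Capping at [k] sends all unassigned classes to the last of the [k.+1] parts. *)
pose g A : 'I_k.+1 := inord (minn (f A) k).
pose P i := [set A in U | g A == i].
exists (fun i => cover (P i)).
have coverP i v : (v \in cover (P i)) = (g (pblock U v) == i).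
  apply/bigcupP/eqP => [[A] | <-].
    by rewrite inE => /andP[UA /eqP <-] Av; rewrite (def_pblock tiU UA Av).
  by exists (pblock U v); rewrite ?inE ?eqxx ?pblock_mem ?mem_pblock ?coverU ?inE.
have sP i : P i \subset U by apply/subsetP => A; rewrite inE => /andP[].
have cardP i : #|cover (P i)| = (\sum_(A in U | g A == i) #|A|)%N.
  rewrite -(eqP (trivIsetS (sP i) tiU)); apply: eq_bigl => A; by rewrite inE.
have gE A (i : nat) : (i < k)%N -> (val (g A) == i) = (f A == i).
  by move=> lt_ik; rewrite /g /= inordK ?ltnS ?geq_minr // /minn; case: ltnP; lia.
split; [split|] => [i j ne_ij||i].
- apply/setP => v; rewrite in_setI !coverP in_set0; apply/negP => /andP[/eqP -> /eqP e].
  by rewrite e eqxx in ne_ij.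
- by apply/setP => v; rewrite !inE; apply/bigcupP; exists (g (pblock U v)); rewrite ?coverP.
suff [h1 h2] : (#|T| <= 3 * k.+1 * #|cover (P i)|)%N /\ (k.+1 * #|cover (P i)| <= 3 * #|T|)%N.
  by split=> //; exists (P i).
rewrite cardP; case: (ltnP i k) => [lt_ik | le_ki].
  case: (arith (\sum_(A in U | g A == i) #|A|)%N) => _ h _; apply: h.
  rewrite (eq_bigl (fun A => (A \in U) && (f A == i))); first exact: fP.
  by move=> A; rewrite -(gE A i lt_ik).
set t := (\sum_(j < k) \sum_(A in U | f A == j) #|A|)%N.
have -> : (\sum_(A in U | g A == i) #|A| = #|T| - t)%N.
  have -> : t = (\sum_(A in U | g A != i) #|A|)%N.
    have i_max : i = ord_max by apply: val_inj; rewrite /=; have := ltn_ord i; lia.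
    rewrite (partition_big g predT) //= big_ord_recr /= [X in (_ + X)%N]big1 ?addn0 => [|A].
      apply: eq_bigr => j _; apply: eq_bigl => A.
      rewrite -(gE A j (ltn_ord j)) -andbA; congr (_ && _).
      have -> : (g A == widen_ord (leqnSn k) j) = (val (g A) == j) by rewrite -val_eqE.
      by rewrite i_max -val_eqE /=; case: eqP => [->|]; rewrite ?andbF // neq_ltn ltn_ord.
    by rewrite i_max => /andP[/andP[_ /negPf ->]].
  by rewrite -sumU [in RHS](bigID (fun A => g A == i)) /= addnK.
case: (arith t) => _ _; apply; rewrite /= -[X in (X * a)%N]card_ord -[X in (X * (a + s))%N]card_ord.
rewrite -!sum_nat_const; apply/andP; split; apply: leq_sum => j _; by case/andP: (fP j (ltn_ord j)).
Qed.

(* Asymptotics and the limit of the probability *)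
From mathcomp Require Import all_classical all_reals all_analysis.

Import Order.TTheory GRing.Theory Num.Theory.
Import numFieldNormedType.Exports.

Local Open Scope classical_set_scope.
Local Open Scope ring_scope.

(** The square of [d n] is at least n times exp(2 eps ln n). The quadratic term of the exponential
    series is at least [kappa] times the square of the binary logarithm [m], which eventually beats
    the linear A(m + 1). *)
Lemma near_log_mul_le_sqr (R : realType) (eps : R) (d : nat -> nat) (A : nat) :
    0 < eps ->
    (\forall n \near \oo, n%:R `^ (2^-1 + eps) <= (d n)%:R :> R) ->
  \forall n \near \oo, (A * (trunc_log 2 n).+1 * n <= d n ^ 2)%N.
Proof.
move=> eps_gt0 d_lb; pose kappa : R := 2 * eps ^+ 2 * ln 2 ^+ 2.
have ln2_gt0 : 0 < ln 2 :> R by rewrite ln_gt0 // ltr1n.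
have kappa_gt0 : 0 < kappa by rewrite /kappa !mulr_gt0 ?exprn_gt0.
pose M := (Num.bound (2 * A%:R / kappa)).+1.
have M_big : 2 * A%:R <= kappa * M%:R.
  rewrite -ler_pdivrMl // mulrC; apply/ltW/(lt_le_trans (archi_boundP _)).
    by rewrite divr_ge0 ?mulr_ge0 // ltW.
  by rewrite ler_nat.
near=> n; have n_big : (2 ^ M <= n)%N by near: n; exists (2 ^ M)%N.
have n_gt0 : (0 < n)%N by apply: leq_trans n_big; rewrite expn_gt0.
have dn : n%:R `^ (2^-1 + eps) <= (d n)%:R :> R by near: n.
set m := trunc_log 2 n.
have Mm : (M <= m)%N by rewrite /m -(@trunc_expnK 2 M) // leq_trunc_log.
have m_gt0 : (0 < m)%N by apply: leq_trans Mm.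
have ln_m : m%:R * ln 2 <= ln n%:R :> R.
  rewrite mulr_natl -lnXn // ler_ln ?posrE ?exprn_gt0 ?ltr0n //.
  by rewrite -natrX ler_nat trunc_logP.
have nR_gt0 : 0 < n%:R :> R by rewrite ltr0n.
have exp_big : A%:R * m.+1%:R <= expR (2 * (eps * ln n%:R)).
  have x_ge0 : 0 <= 2 * (eps * ln n%:R).
    apply: mulr_ge0 => //; apply: mulr_ge0; first exact: ltW.
    by rewrite ln_ge0 // ler1n.
  have := expR_ge1Dxn 1 x_ge0.
  have h1 : kappa * m%:R ^+ 2 <= (2 * (eps * ln n%:R)) ^+ 2 / 2.
    have -> : kappa * m%:R ^+ 2 = 2 * eps ^+ 2 * (m%:R * ln 2) ^+ 2 by rewrite /kappa; ring.
    have -> : (2 * (eps * ln n%:R)) ^+ 2 / 2 = 2 * eps ^+ 2 * ln n%:R ^+ 2 by field.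
    have mln_ge0 : 0 <= m%:R * ln 2 :> R by rewrite mulr_ge0 // ltW.
    rewrite ler_pM2l ?mulr_gt0 ?exprn_gt0 //; apply: lerXn2r => //; rewrite nnegrE //.
    exact: le_trans ln_m.
  have h2 : A%:R * m.+1%:R <= kappa * m%:R ^+ 2.
    have : kappa * M%:R <= kappa * m%:R by rewrite ler_pM2l // ler_nat.
    have : 1 <= m%:R :> R by rewrite ler1n.
    have : 0 <= A%:R :> R by rewrite ler0n.
    rewrite -natr1; move: M_big; move: (A%:R) (M%:R) (m%:R) => A' M' m' h a0 m1 h'; nra.
  rewrite (_ : (2`!)%:R = 2 :> R) //; apply: le_trans.
  by apply: le_trans h2 (le_trans h1 _); rewrite lerDr ler01.
rewrite -(ler_nat R) natrX 2!natrM.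
apply: (@le_trans _ _ ((n%:R `^ (2^-1 + eps)) ^+ 2)); last first.
  by rewrite lerXn2r ?nnegrE ?powR_ge0.
have -> : (n%:R `^ (2^-1 + eps)) ^+ 2 = n%:R * expR (2 * (eps * ln n%:R)).
  rewrite /powR gt_eqF // expr2 -expRD -[X in _ = X * _](lnK (_ : n%:R \is Num.pos)) ?posrE //.
  by rewrite -expRD; congr expR; field.
by rewrite mulrC ler_pM2l.
Unshelve. all: by end_near. Qed.

(** The bad fraction is at most 2 / 2^l, hence at most 2/(n + 1), which is [2 * harmonic n]. *)
Lemma regular_graph_prob_lb (R : realType) n d l (bad : {set sgraph 'I_n})
    (E : sgraph 'I_n -> Prop) :
    (0 < #|regular_graphs 'I_n d|)%N -> (n.+1 <= 2 ^ l)%N ->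
    (#|bad| * 2 ^ l <= 2 * #|regular_graphs 'I_n d|)%N ->
    (forall G, G \in regular_graphs 'I_n d -> G \notin bad -> E G) ->
  1 - 2 * harmonic n <= regular_graph_prob R d E <= 1.
Proof.
move=> N_gt0 nl le_bad good; rewrite /regular_graph_prob.
set N := #|_| in N_gt0 le_bad *; set Y := [set G in _ | _]%SET.
have NR : 0 < N%:R :> R by rewrite ltr0n.
have leY : (#|Y| <= N)%N by apply/subset_leq_card/fintype.subsetP => G; rewrite inE => /andP[].
have leN : (N <= #|Y| + #|bad|)%N.
  apply: leq_trans (leq_card_setU Y bad).1; apply/subset_leq_card/fintype.subsetP => G rG.
  rewrite finset.in_setU; case: (boolP (G \in bad)) => [|Gbad]; rewrite ?orbT //.
  by rewrite orbF inE rG; apply/asboolP/good.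
have le_bad' : (#|bad| * n.+1 <= 2 * N)%N by apply: leq_trans le_bad; rewrite leq_mul2l nl orbT.
apply/andP; split; last by rewrite ler_pdivrMr // mul1r ler_nat.
rewrite ler_pdivlMr // mulrBl mul1r lerBlDr.
apply: (@le_trans _ _ (#|Y|%:R + #|bad|%:R)); first by rewrite -natrD ler_nat.
rewrite lerD2l /harmonic /= mulrAC ler_pdivlMr ?ltr0n //.
by rewrite -!natrM ler_nat.
Qed.

Theorem theorem8 (R : realType) (eps : R) (d : nat -> nat) (k : nat)
    (eps_gt0 : 0 < eps) (eps_lt : eps < 2^-1)
    (d_bounds : \forall n \near \oo,
       n%:R `^ (2^-1 + eps) <= (d n)%:R :> R /\ (d n)%:R <= n%:R / 2 :> R)
    (d_even : \forall n \near \oo, ~~ odd (d n * n))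
    (k_gt0 : (0 < k)%N) :
  regular_graph_prob R (d n) (fun G : sgraph 'I_n =>
    forall V1 V2 : {set 'I_n}, nontrivial_bipartition V1 V2 ->
      exists W : 'I_k -> {set 'I_n},
        partition_family W /\
        forall i : 'I_k,
          n%:R / (3 * k%:R) <= #|W i|%:R :> R /\
          #|W i|%:R <= 3 * n%:R / k%:R :> R /\
          union_of_colour_classes
            (refine_colouring G (refine_colouring G (two_part_colouring V1)))
            (W i))
    @[n --> \oo] --> (1 : R).
Proof.
(* Classes of size at most n/(4k^2) are what the packing into [k] parts requires. *)
pose c := (4 * k ^ 2)%N.
have c_gt0 : (0 < c)%N by rewrite muln_gt0 expn_gt0 k_gt0.
have [A hA] := exists_parameters c_gt0.
have d_lb : \forall n \near \oo, n%:R `^ (2^-1 + eps) <= (d n)%:R :> R.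
  by apply: filterS d_bounds => n [].
have big := near_log_mul_le_sqr A eps_gt0 d_lb.
apply: (@squeeze_cvgr _ _ _ _ (fun n => 1 - 2 * harmonic n) (fun=> 1)); last 2 first.
- rewrite -[X in _ --> X]subr0 -(mulr0 2); apply: cvgB; first exact: cvg_cst.
  by apply: cvgM; [exact: cvg_cst | exact: cvg_harmonic].
- exact: cvg_cst.
near=> n.
have n_gt0 : (0 < n)%N by near: n; exists 1%N.
have dn : (2 * d n <= n)%N.
  have [_] : n%:R `^ (2^-1 + eps) <= (d n)%:R :> R /\ (d n)%:R <= n%:R / 2 :> R by near: n.
  by rewrite ler_pdivlMr // -natrM ler_nat mulnC.
have dn_even : ~~ odd (d n * n) by near: n.
have hd : (A * (trunc_log 2 n).+1 * n <= d n ^ 2)%N by near: n.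
set l := (trunc_log 2 n).+1 in hd.
have nl : (n.+1 <= 2 ^ l)%N by apply: trunc_log_ltn.
have [r [K [L [q [hK [[r_gt0 rd_small c_le] rd_big hL hq hr]]]]]] := hA n (d n) l dn nl n_gt0 hd.
pose bad := (clustered_graphs 'I_n (d n) r c :|: flat_graphs 'I_n (d n) r)%SET.
apply: (@regular_graph_prob_lb R n (d n) l bad) => //.
- exact: exists_regular_graph.
- by apply: (@card_bad_graphs R _ _ _ _ K L q); rewrite ?card_ord.
move=> G rG; rewrite finset.in_setU negb_or => /andP[clG flG] V1 V2 V12.
have [|v|W [partW WP]] := @exists_balanced_union _ _
  (refine_colouring G (refine_colouring G (two_part_colouring V1))) k k_gt0.
- by rewrite card_ord.
- by apply: colour_class_bound rG clG flG _ V12; rewrite card_ord; lia.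
exists W; split=> // i; have [] := WP i; rewrite card_ord => lb ub cupW; split; last split=> //.
  by rewrite ler_pdivrMr ?mulr_gt0 ?ltr0n // mulrC -!natrM ler_nat.
by rewrite ler_pdivlMr ?ltr0n // mulrC -!natrM ler_nat.
Unshelve. all: by end_near. Qed.
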